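(* Let $F$ be an entire function with at least one zero, and $\ell\in\mathbb{Z}$. Its Newton map $N_F(z)=z-F(z)/F'(z)$ belongs to the class $\mathbf{R}_\ell$ if and only if $\ell=1$ and $$F(z)=e^{\Lambda z}\Psi(e^{2\pi iz}),\qquad \Psi(w)=w^{m_0}P(w)e^{Q(w)+\widetilde{Q}(1/w)},$$ where $\Lambda\in\mathbb{C}$, $m_0\in\mathbb{Z}$, and $P,Q,\widetilde{Q}$ are polynomials with $P(0)\neq0$ and $P^{-1}(0)\cap\mathbb{C}^*\neq\emptyset$; in addition $\Lambda\neq-2\pi i(m_0+\deg P)$ if $Q$ is constant, and $\Lambda\neq-2\pi i m_0$ if $\widetilde{Q}$ is constant.
   Context: For $\ell\in\mathbb{Z}$, $\mathbf{R}_\ell$ is the class of meromorphic functions $f(z)=\ell z+R(e^{2\pi iz})$ where $R$ is a non-constant rational map with $R(0)\neq\infty$, $R(\infty)\neq\infty$ and $R^{-1}(\infty)\neq\emptyset$ (i.e. $R=\frac{a_nw^n+\dots+a_0}{b_mw^m+\dots+b_0}$ with coprime numerator and denominator, $m\ge\max\{n,1\}$, $a_n,b_m,b_0\neq0$). *)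

(* Defs.v *)
From HB Require Import structures.
From mathcomp Require Import all_boot all_order all_algebra.
From mathcomp Require Import all_classical all_reals all_analysis.
From mathcomp Require Import complex.
Set Implicit Arguments.
Unset Strict Implicit.
Unset Printing Implicit Defensive.
Import Order.TTheory GRing.Theory Num.Theory.
Import numFieldNormedType.Exports.
Local Open Scope ring_scope.

(* the complex numbers C = R[i], viewed as a numClosedFieldType, hence
   (via numFieldNormedType) a normed module over itself: derivatives below
   are complex derivatives. *)
Definition CC (R : realType) : numClosedFieldType := R[i].

Definition cexp (R : realType) (z : CC R) : CC R :=
  Complex (expR (complex.Re z) * cos (complex.Im z)) (expR (complex.Re z) * sin (complex.Im z)) : R[i].

Definition two_pi_i (R : realType) : CC R := Complex 0 (2 * pi) : R[i].

Definition entire (R : realType) (F : CC R -> CC R) : Prop :=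
  forall z : CC R, derivable F z 1.

Definition cderiv (R : realType) (F : CC R -> CC R) (z : CC R) : CC R :=
  'D_1 F z.

(* Newton map N_F(z) = z - F(z)/F'(z) (meaningful where F'(z) <> 0) *)
Definition newton (R : realType) (F : CC R -> CC R) (z : CC R) : CC R :=
  z - F z / cderiv F z.

(* R = p/q (p, q coprime) is an admissible rational map for the class R_l:
   non-constant, R(0) <> oo, R(oo) <> oo, R^{-1}(oo) nonempty. *)
Definition admissible_rat (R : realType) (p q : {poly CC R}) : Prop :=
  [/\ coprimep p q,
      (exists w1 w2 : CC R, [/\ q.[w1] != 0, q.[w2] != 0 &
                               p.[w1] / q.[w1] != p.[w2] / q.[w2]]),
      (* R(0) <> oo *) q.[0] != 0,
      (* R(oo) <> oo *) (size p <= size q)%N &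
      (* R^{-1}(oo) <> empty *) (exists w : CC R, root q w)].

(* The meromorphic function N_F belongs to R_l: N_F(z) = l z + R(e^{2 pi i z})
   as meromorphic functions, i.e. equality wherever both formulas are defined
   (the complement of a discrete set). *)
Definition newton_in_Rl (R : realType) (F : CC R -> CC R) (l : int) : Prop :=
  exists p q : {poly CC R}, admissible_rat p q /\
    forall z : CC R, cderiv F z != 0 -> q.[cexp (two_pi_i R * z)] != 0 ->
      newton F z = l%:~R * z + p.[cexp (two_pi_i R * z)] / q.[cexp (two_pi_i R * z)].

(* Main.v *)
(* Write [w = e^(2 pi i z)], [c = 1 - l] and [H(z) = c z q(w) - p(w)], where [N_F] is
   [l z + p(w) / q(w)]. The Newton equation says that off a discrete set either [F' = 0] or
   [F' / F = q(w) / H]. The complement of a discrete set is connected and the derivative of a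
   real function has the intermediate value property, so the second alternative holds
   everywhere off that set. Zeros of polynomials in [z] and [w] have finite order, hence [F' / F]
   has at worst poles; that [F] is bounded near them and single-valued around them makes them
   simple with residue a positive integer [n], i.e. [q(w) = n H'] at the zeros of [H].

   If [c <> 0], the minimum modulus principle yields zeros of [H] at which [w] is as close as we
   please to a root of [q]. There [z = p(w) / (c q(w))] turns [q(w) = n H'] into a bound on the
   derivative of [p / q], which is impossible next to a pole. So [l = 1] and
   [F' / F = - q(w) / p(w)] has, as a function of [w], simple poles with integral residues away
   from [0]: it is the sum of [P' / P], for a polynomial [P], and of a Laurent polynomial, and it
   integrates to the required form. The conditions on [Lam] say that the rational map is finite
   at [0] and at infinity. Conversely, differentiating that form gives a rational map. *)

Require Import Defs.
From HB Require Import structures.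
From mathcomp Require Import all_boot all_order all_algebra.
From mathcomp Require Import all_classical all_reals all_analysis.
From mathcomp Require Import complex ring lra.
Import Order.TTheory GRing.Theory Num.Theory.
Import numFieldNormedType.Exports.
Local Open Scope classical_set_scope.
Local Open Scope ring_scope.

Set Implicit Arguments.
Unset Strict Implicit.
Unset Printing Implicit Defensive.

Local Notation Re := (@complex.Re _).
Local Notation Im := (@complex.Im _).

(** * Derivatives over a numeric field *)

Section DerivativeNumField.
Variable K : numFieldType.
Implicit Types (f g : K -> K) (x z d e : K) (P : set K).

Lemma continuous_near_neq f g z : {for z, continuous f} -> {for z, continuous g} ->
  f z != g z -> \forall x \near z, f x != g x.
Proof.
rewrite -subr_eq0 => fc gc fgz.
by apply: filterS (cvgr_neq0 (f z - g z) (cvgB fc gc) fgz) => x; rewrite subr_eq0.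
Qed.

Lemma near_dnbhs_near z P :
  (\forall x \near z^', P x) -> \forall x \near z, \forall y \near x^', P y.
Proof.
move=> zP; have /nbhs_interior : nbhs z (fun x => x != z -> P x) by exact: zP.
apply: filterS => x /= xP; have [->|xz] := eqVneq x z; first exact: zP.
have xnz : \forall y \near x, y != z.
  by apply: (@continuous_near_neq id (cst z)) => //; exact: cst_continuous.
by apply: nbhs_dnbhs; apply: filterS2 xP xnz => y; exact.
Qed.

Lemma is_derive_continuous f z d : is_derive z 1 f d -> {for z, continuous f}.
Proof. by move=> [df _]; apply/differentiable_continuous/derivable1_diffP. Qed.

Lemma is_derive_unique f z d e : is_derive z 1 f d -> is_derive z 1 f e -> d = e.
Proof. by move=> [_ <-] [_ <-]. Qed.

Lemma is_derive_caratheodoryP f z d : is_derive z 1 f d <->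
  exists g, [/\ {for z, continuous g}, g z = d & forall x, f x = f z + g x * (x - z)].
Proof.
pose slope h := h^-1 *: ((f \o shift z) (h *: 1) - f z).
have slopeE h : slope h = (f (h + z) - f z) / h by rewrite /slope /= [h%:A]mulr1 [LHS]mulrC.
split=> [[df <-]|[g [gz <- fE]]].
  exists (fun x => if x == z then 'D_1 f z else (f x - f z) / (x - z)); split.
  - apply/continuous_withinNshiftx; rewrite eqxx; apply: cvg_trans df.
    apply: near_eq_cvg; near=> h; rewrite -/(slope h) slopeE /= addrK ifN//.
    by rewrite -subr_eq0 addrK; near: h; exact: nbhs_dnbhs_neq.
  - by rewrite eqxx.
  - move=> x; case: eqVneq => [->|xz]; first by rewrite subrr mulr0 addr0.
    by rewrite divfK ?subr_eq0// addrC subrK.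
have slope_cvg : slope @ 0^' --> g z.
  move/continuous_withinNshiftx: gz; apply: cvg_trans; apply: near_eq_cvg.
  near=> h; rewrite slopeE /= fE [f z + _]addrC !addrK mulfK//.
  by near: h; exact: nbhs_dnbhs_neq.
by split; [apply/cvg_ex; exists (g z)|exact: cvg_lim slope_cvg].
Unshelve. all: by end_near. Qed.

Lemma is_derive_comp f g z d e :
  is_derive z 1 g d -> is_derive (g z) 1 f e -> is_derive z 1 (f \o g) (e * d).
Proof.
move=> dg /is_derive_caratheodoryP[f' [f'c <- fE]].
have gc := is_derive_continuous dg.
move/is_derive_caratheodoryP: dg => [g' [g'c <- gE]].
apply/is_derive_caratheodoryP; exists (fun x => f' (g x) * g' x); split=> //.
  by apply: (@continuousM K K) => //; exact: continuous_comp.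
move=> x /=; rewrite fE -mulrA; congr (_ + _ * _).
by rewrite [g x]gE addrC addKr.
Qed.

Lemma is_derive_invr f z d : f z != 0 -> is_derive z 1 f d ->
  is_derive z 1 (fun x => (f x)^-1) (- d / f z ^+ 2).
Proof.
move=> fz0 [df <-]; apply: DeriveDef; first exact: derivableV.
by rewrite deriveV// [LHS]mulrC mulrN mulNr.
Qed.

Lemma is_derive_horner (p : {poly K}) z : is_derive z 1 (horner p) (p^`()).[z].
Proof.
elim/poly_ind: p => [|p a IH].
  rewrite deriv0 horner0.
  have -> : horner (0 : {poly K}) = cst 0 by apply/funext => x; rewrite horner0.
  exact: is_derive_cst.
have -> : horner (p * 'X + a%:P) = horner p * id + cst a.
  by apply/funext => x; rewrite !hornerE.
apply: is_derive_eq.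
by rewrite derivD derivM derivX derivC !hornerE /= /GRing.scale /=; ring.
Qed.

End DerivativeNumField.

(** * Modulus and topology of the complex plane *)

Section Modulus.
Variable R : realType.
Implicit Types (u z w : CC R) (r s t : R) (n : nat).

Definition RtoC r : CC R := (r%:C)%C.

HB.instance Definition _ := GRing.RMorphism.copy RtoC (real_complex R).

Lemma RtoC_inj : injective RtoC. Proof. exact: complexI. Qed.

Lemma RtoC_eq0 r : (RtoC r == 0) = (r == 0).
Proof. by rewrite -(inj_eq RtoC_inj) rmorph0. Qed.

Lemma ler_RtoC r s : (RtoC r <= RtoC s) = (r <= s). Proof. exact: lecR. Qed.
Lemma ltr_RtoC r s : (RtoC r < RtoC s) = (r < s). Proof. exact: ltcR. Qed.

Lemma complex_eqP z w : Re z = Re w -> Im z = Im w -> z = w.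
Proof. by case: z w => [a b] [c d] /= -> ->. Qed.

Lemma complex_ReD z w : Re (z + w) = Re z + Re w.
Proof. by case: z w => [a b] [c d]. Qed.

Lemma complex_ImD z w : Im (z + w) = Im z + Im w.
Proof. by case: z w => [a b] [c d]. Qed.

Lemma complex_ReB z w : Re (z - w) = Re z - Re w.
Proof. by case: z w => [a b] [c d]. Qed.

Lemma complex_ImB z w : Im (z - w) = Im z - Im w.
Proof. by case: z w => [a b] [c d]. Qed.

Lemma complex_ReM z w : Re (z * w) = Re z * Re w - Im z * Im w.
Proof. by case: z w => [a b] [c d]. Qed.

Lemma complex_ImM z w : Im (z * w) = Re z * Im w + Im z * Re w.
Proof. by case: z w => [a b] [c d]. Qed.

Definition cabs z : R := Re `|z|.

Lemma RtoC_cabs z : RtoC (cabs z) = `|z|.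
Proof. by rewrite /RtoC /cabs normc_def. Qed.

Lemma cabs_ge0 z : 0 <= cabs z.
Proof. by rewrite -ler_RtoC rmorph0 RtoC_cabs. Qed.

Lemma cabs0 : cabs 0 = 0. Proof. by rewrite /cabs normr0. Qed.
Lemma cabs1 : cabs 1 = 1. Proof. by rewrite /cabs normr1. Qed.
Lemma cabsN z : cabs (- z) = cabs z. Proof. by rewrite /cabs normrN. Qed.

Lemma cabsM z w : cabs (z * w) = cabs z * cabs w.
Proof. by apply: RtoC_inj; rewrite rmorphM /= !RtoC_cabs normrM. Qed.

Lemma cabsV z : cabs z^-1 = (cabs z)^-1.
Proof. by apply: RtoC_inj; rewrite fmorphV /= !RtoC_cabs normfV. Qed.

Lemma cabsX z n : cabs (z ^+ n) = cabs z ^+ n.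
Proof. by apply: RtoC_inj; rewrite rmorphXn /= !RtoC_cabs normrX. Qed.

Lemma cabsD z w : cabs (z + w) <= cabs z + cabs w.
Proof. by rewrite -ler_RtoC rmorphD /= !RtoC_cabs ler_normD. Qed.

Lemma cabsBC z w : cabs (z - w) = cabs (w - z).
Proof. by rewrite /cabs distrC. Qed.

Lemma cabs_eq0 z : (cabs z == 0) = (z == 0).
Proof. by rewrite -RtoC_eq0 RtoC_cabs normr_eq0. Qed.

Lemma cabs_gt0 z : (0 < cabs z) = (z != 0).
Proof. by rewrite lt_neqAle eq_sym cabs_eq0 cabs_ge0 andbT. Qed.

Lemma cabs_RtoC r : cabs (RtoC r) = `|r|.
Proof. by rewrite /cabs normc_def /= expr0n /= addr0 sqrtr_sqr. Qed.

Lemma cabs_nat n : cabs n%:R = n%:R.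
Proof. by rewrite -(rmorph_nat RtoC) cabs_RtoC normr_nat. Qed.

Lemma cabsB_ge z w : cabs z - cabs w <= cabs (z - w).
Proof. by rewrite lerBlDr -{1}(subrK w z) cabsD. Qed.

Lemma sqr_cabs z : cabs z ^+ 2 = Re z ^+ 2 + Im z ^+ 2.
Proof. by apply: RtoC_inj; rewrite rmorphXn /= RtoC_cabs -add_Re2_Im2. Qed.

Lemma cabsE z r : 0 <= r -> Re z ^+ 2 + Im z ^+ 2 = r ^+ 2 -> cabs z = r.
Proof. by move=> r0; rewrite -sqr_cabs => /eqP; rewrite eqrXn2 ?cabs_ge0// => /eqP. Qed.

Lemma Re_le_cabs z : `|Re z| <= cabs z.
Proof.
by rewrite -ler_sqr ?nnegrE ?cabs_ge0// sqr_cabs real_normK ?num_real// lerDl sqr_ge0.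
Qed.

Lemma Im_le_cabs z : `|Im z| <= cabs z.
Proof.
by rewrite -ler_sqr ?nnegrE ?cabs_ge0// sqr_cabs real_normK ?num_real// lerDr sqr_ge0.
Qed.

Lemma cabs_le_ReIm z : cabs z <= `|Re z| + `|Im z|.
Proof.
rewrite -ler_sqr ?nnegrE ?addr_ge0 ?cabs_ge0// sqr_cabs sqrrD !real_normK ?num_real//.
by rewrite -addrA [X in _ <= _ + X]addrC addrA lerDl mulrn_wge0 ?mulr_ge0.
Qed.

Lemma near_cabsP z (P : set (CC R)) :
  (\forall x \near z, P x) <-> exists2 d, 0 < d & forall x, cabs (x - z) < d -> P x.
Proof.
split=> [/nbhs_ballP[e /= e0 zP]|[d d0 zP]]; last first.
  apply/nbhs_ballP; exists (RtoC d) => [/=|x]; first by rewrite -(rmorph0 RtoC) ltr_RtoC.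
  by rewrite /ball/= /ball_ /= -RtoC_cabs ltr_RtoC cabsBC => /zP.
have eE : e = RtoC (Re e) by case: e e0 {zP} => a b; rewrite ltcE /= => /andP[/eqP->].
exists (Re e) => [|x xz]; first by rewrite -ltr_RtoC -eE rmorph0.
by apply: zP; rewrite /ball/= /ball_ /= eE -RtoC_cabs ltr_RtoC cabsBC.
Qed.

Lemma near_punctured_cabsP z (P : set (CC R)) : (\forall x \near z^', P x) <->
  exists2 d, 0 < d & forall x, x != z -> cabs (x - z) < d -> P x.
Proof.
rewrite near_withinE; split=> [/near_cabsP[d d0 zP]|[d d0 zP]].
  by exists d => // x xz xd; exact: zP.
by apply/near_cabsP; exists d => // x xd xz; exact: zP.
Qed.

Lemma near_ray z u (P : set (CC R)) : (\forall x \near z^', P x) -> u != 0 ->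
  exists2 t, 0 < t <= 1 & forall s, 0 < s <= t -> P (z + RtoC s * u).
Proof.
move=> /near_punctured_cabsP[r r0 zP] u0; have u1 : 0 < cabs u by rewrite cabs_gt0.
exists (Num.min 1 (r / 2 / cabs u)) => [|s /andP[s0]].
  by rewrite lt_min ltr01 ge_min lexx !divr_gt0.
rewrite le_min ler_pdivlMr// => /andP[_ sr]; have s_neq0 : RtoC s != 0 by rewrite RtoC_eq0 gt_eqF.
apply: zP; first by rewrite -subr_eq0 addrC addKr mulf_neq0.
by rewrite addrC addKr cabsM cabs_RtoC gtr0_norm//; lra.
Qed.

Lemma continuous_cabsP (f : CC R -> CC R) z : {for z, continuous f} <->
  forall e, 0 < e -> \forall x \near z, cabs (f x - f z) < e.
Proof.
split=> [fz e e0|fz A /near_cabsP[e e0 Ae]].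
  by apply: (fz [set y | cabs (y - f z) < e]); apply/near_cabsP; exists e.
by apply: filterS (fz e e0) => x /Ae.
Qed.

Lemma cabs_lipschitz_continuous (f : CC R -> R) :
  (forall z w, `|f z - f w| <= cabs (z - w)) -> continuous f.
Proof.
move=> lipf z A /nbhs_ballP[e /= e0 Ae]; apply/near_cabsP; exists e => // x xz.
by apply: Ae; rewrite /ball /= distrC; exact: le_lt_trans (lipf x z) xz.
Qed.

Lemma continuous_cabs : continuous cabs.
Proof.
apply: cabs_lipschitz_continuous => z w.
by rewrite ler_norml cabsB_ge andbT lerNl opprB cabsBC cabsB_ge.
Qed.

Lemma continuous_Re : continuous (Re : CC R -> R).
Proof. by apply: cabs_lipschitz_continuous => z w; rewrite -complex_ReB Re_le_cabs. Qed.

Lemma continuous_Im : continuous (Im : CC R -> R).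
Proof. by apply: cabs_lipschitz_continuous => z w; rewrite -complex_ImB Im_le_cabs. Qed.

Lemma continuous_cabs_comp (f : CC R -> CC R) z :
  {for z, continuous f} -> {for z, continuous (fun x => cabs (f x))}.
Proof. by move=> fc; apply: continuous_comp; [exact: fc|exact: continuous_cabs]. Qed.

Lemma continuous_Re_div (f : CC R -> CC R) z w :
  {for z, continuous f} -> {for z, continuous (fun x => Re (f x / w))}.
Proof.
move=> fc; apply: (@continuous_comp _ _ _ (fun x => f x / w)); last exact: continuous_Re.
by apply: (@continuousM (CC R) (CC R)); [exact: fc|exact: cst_continuous].
Qed.

Lemma continuous_mul_Re_Im (g h : R -> R) z :
  {for Re z, continuous g} -> {for Im z, continuous h} ->
  {for z, continuous (fun x : CC R => g (Re x) * h (Im x))}.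
Proof.
move=> gc hc; apply: continuousM; apply: continuous_comp.
- exact: continuous_Re.
- exact: gc.
- exact: continuous_Im.
- exact: hc.
Qed.

Lemma continuous_RtoC : continuous RtoC.
Proof.
move=> t A /near_cabsP[e e0 Ae]; apply/nbhs_ballP; exists e => //= x.
by rewrite /ball /= distrC => xt; apply: Ae; rewrite -rmorphB cabs_RtoC.
Qed.

Lemma continuous_Complex : continuous (fun uv : R * R => Complex uv.1 uv.2 : CC R).
Proof.
have -> : (fun uv : R * R => Complex uv.1 uv.2 : CC R) =
    (fun uv => RtoC uv.1) \+ (fun uv => Complex 0 1 * RtoC uv.2).
  apply/funext => uv; apply: complex_eqP;
    by rewrite ?(complex_ReD, complex_ImD, complex_ReM, complex_ImM) /=; ring.
move=> uv; apply: cvgD.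
  by apply: continuous_comp; [exact: cvg_fst|exact: continuous_RtoC].
apply: (@cvgM (CC R)); first exact: cvg_cst.
by apply: continuous_comp; [exact: cvg_snd|exact: continuous_RtoC].
Qed.

Lemma closed_cabs_bounded_compact (A : set (CC R)) r :
  closed A -> (forall x, A x -> cabs x <= r) -> compact A.
Proof.
move=> Acl Ar; pose square := `[- r, r] `*` `[- r, r].
have squareK : compact square by apply: compact_setX; exact: segment_compact.
have imageK := continuous_compact (continuous_subspaceT continuous_Complex) squareK.
apply: subclosed_compact Acl imageK _ => x /Ar xr; exists (Re x, Im x); last by case: x {xr}.
split; rewrite /= in_itv /= -ler_norml; apply: le_trans xr.
  exact: Re_le_cabs.
exact: Im_le_cabs.
Qed.

End Modulus.

(** * The complex exponential *)

Section ComplexExponential.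
Variable R : realType.
Implicit Types (z w : CC R) (f : CC R -> CC R).

Lemma is_derive_of_near_le f z d :
  (forall e, 0 < e -> \forall x \near z, cabs (f x - f z - d * (x - z)) <= e * cabs (x - z)) ->
  is_derive z 1 f d.
Proof.
move=> fd; apply/is_derive_caratheodoryP.
exists (fun x => if x == z then d else (f x - f z) / (x - z)); split.
- apply/continuous_cabsP => e e0; have e20 : 0 < e / 2 by rewrite divr_gt0.
  apply: filterS (fd _ e20) => x; rewrite eqxx; case: eqVneq => [_ _|xz].
    by rewrite subrr cabs0.
  have xz0 : x - z != 0 by rewrite subr_eq0.
  rewrite -ler_pdivrMr ?cabs_gt0// -cabsV -cabsM mulrBl mulfK// => /le_lt_trans; apply.
  by rewrite ltr_pdivrMr// ltr_pMr// ltr1n.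
- by rewrite eqxx.
- move=> x; case: eqVneq => [->|xz]; first by rewrite subrr mulr0 addr0.
  by rewrite divfK ?subr_eq0// addrC subrK.
Qed.

Lemma cexpD z w : cexp (z + w) = cexp z * cexp w.
Proof.
by apply: complex_eqP; rewrite ?complex_ReM ?complex_ImM /= complex_ReD complex_ImD
  expRD ?cosD ?sinD; ring.
Qed.

Lemma cexp0 : cexp (0 : CC R) = 1.
Proof. by apply: complex_eqP; rewrite /= expR0 ?cos0 ?sin0 mul1r. Qed.

Lemma cexp_neq0 z : cexp z != 0.
Proof.
apply/eqP => z0; have := cexpD z (- z).
by rewrite subrr cexp0 z0 mul0r => /eqP; rewrite oner_eq0.
Qed.

Lemma cexpN z : cexp (- z) = (cexp z)^-1.
Proof. by apply: (mulfI (cexp_neq0 z)); rewrite -cexpD subrr cexp0 divff ?cexp_neq0. Qed.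

Lemma cabs_cexp z : cabs (cexp z) = expR (Re z).
Proof. by apply: cabsE (expR_ge0 _) _; rewrite /= !exprMn -mulrDr cos2Dsin2 mulr1. Qed.

Lemma is_derive_cexp0 : is_derive (0 : CC R) 1 (@cexp R) 1.
Proof.
have [gexp [gexp_cont gexp0 expE]] := (is_derive_caratheodoryP _ _ _).1 (@is_derive_expR R 0).
have [gcos [gcos_cont gcos0 cosE]] := (is_derive_caratheodoryP _ _ _).1 (@is_derive_cos R 0).
have [gsin [gsin_cont gsin0 sinE]] := (is_derive_caratheodoryP _ _ _).1 (@is_derive_sin R 0).
rewrite expR0 in gexp0 expE; rewrite sin0 oppr0 in gcos0; rewrite cos0 in gsin0 cosE.
rewrite sin0 in sinE.
pose k z : R := `|gexp (Re z) - 1| +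
  (`|expR (Re z) * gcos (Im z) - 0| + `|expR (Re z) * gsin (Im z) - 1|).
have k_cont : {for 0, continuous k}.
  have dist (f : CC R -> R) c : {for (0 : CC R), continuous f} ->
      {for (0 : CC R), continuous (fun z : CC R => `|f z - c|)}.
    move=> fc; apply: continuous_comp (@norm_continuous _ R _).
    by apply: continuousB => //; exact: cst_continuous.
  apply: continuousD; [|apply: continuousD]; apply: dist.
  - by apply: continuous_comp; [exact: continuous_Re|exact: gexp_cont].
  - by apply: (continuous_mul_Re_Im (g := expR)); [exact: continuous_expR|exact: gcos_cont].
  - by apply: (continuous_mul_Re_Im (g := expR)); [exact: continuous_expR|exact: gsin_cont].
have k0 : k 0 = 0 by rewrite /k /= gexp0 gcos0 gsin0 mulr0 expR0 mulr1 !subrr normr0 !addr0.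
have le_k z : cabs (cexp z - cexp 0 - 1 * (z - 0)) <= k z * cabs z.
  have -> : cexp z - cexp 0 - 1 * (z - 0) = RtoC (Re z) * RtoC (gexp (Re z) - 1) +
      RtoC (Im z) * Complex (expR (Re z) * gcos (Im z)) (expR (Re z) * gsin (Im z) - 1).
    rewrite cexp0; apply: complex_eqP;
      rewrite ?(complex_ReB, complex_ImB, complex_ReD, complex_ImD, complex_ReM, complex_ImM) /=.
      by have := expE (Re z); rewrite cosE; lra.
    by rewrite sinE; ring.
  apply: le_trans (cabsD _ _) _; rewrite !cabsM !cabs_RtoC [leRHS]mulrC mulrDr.
  apply: lerD; first by rewrite ler_wpM2r// Re_le_cabs.
  by apply: ler_pM; rewrite ?cabs_ge0 ?Im_le_cabs// subr0 cabs_le_ReIm.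
apply: is_derive_of_near_le => e e0.
have : \forall z \near 0, k z < e.
  by apply: (cvgr_lt _ k_cont); rewrite k0.
apply: filterS => z /ltW kz; apply: le_trans (le_k z) _.
by rewrite subr0 ler_wpM2r// cabs_ge0.
Qed.

Lemma is_derive_cexp z : is_derive z 1 (@cexp R) (cexp z).
Proof.
have cexpE : @cexp R = cexp z \*: (@cexp R \o shift (- z)).
  by apply/funext => x /=; rewrite /GRing.scale /= -cexpD addrC subrK.
have d1 : is_derive z 1 (@cexp R \o shift (- z)) (1 * 1).
  by apply: is_derive_comp; [exact: is_derive_shift|rewrite /= subrr; exact: is_derive_cexp0].
rewrite [X in is_derive _ _ X]cexpE; apply: is_derive_eq (is_deriveZ (cexp z) d1) _.
by rewrite /GRing.scale /= !mulr1.
Qed.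

Lemma cabs_two_pi_i : cabs (two_pi_i R) = 2 * pi.
Proof. by apply: cabsE; rewrite /= ?mulr_ge0 ?pi_ge0// expr0n add0r. Qed.

Lemma two_pi_i_neq0 : two_pi_i R != 0.
Proof. by rewrite -cabs_eq0 cabs_two_pi_i gt_eqF// mulr_gt0// pi_gt0. Qed.

Definition wexp z := cexp (two_pi_i R * z).

Lemma wexpD z w : wexp (z + w) = wexp z * wexp w.
Proof. by rewrite /wexp mulrDr cexpD. Qed.

Lemma wexpN z : wexp (- z) = (wexp z)^-1.
Proof. by rewrite /wexp mulrN cexpN. Qed.

Lemma wexp0 : wexp 0 = 1. Proof. by rewrite /wexp mulr0 cexp0. Qed.

Lemma wexp_neq0 z : wexp z != 0. Proof. exact: cexp_neq0. Qed.

Lemma wexp1 : wexp 1 = 1.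
Proof.
by rewrite /wexp mulr1; apply: complex_eqP; rewrite /= expR0 mul1r mulr_natl ?cos2pi ?sin2pi.
Qed.

Lemma wexp_nat (n : nat) : wexp n%:R = 1.
Proof. by elim: n => [|n IH]; rewrite ?wexp0// -natr1 wexpD IH wexp1 mulr1. Qed.

Lemma wexp_int (n : int) : wexp n%:~R = 1.
Proof. by case: n => n; rewrite ?NegzE ?mulrNz ?wexpN wexp_nat ?invr1. Qed.

Lemma wexpDn z (n : nat) : wexp (z + n%:R) = wexp z.
Proof. by rewrite wexpD wexp_nat mulr1. Qed.

Lemma wexpXz z (m : int) : wexp z ^ m = cexp (two_pi_i R * m%:~R * z).
Proof.
suff natE n : wexp z ^+ n = cexp (two_pi_i R * n%:R * z).
  case: m => n; first exact: natE.
  by rewrite NegzE mulrNz mulrN mulNr cexpN -natE.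
elim: n => [|n IH]; first by rewrite mulr0 mul0r cexp0.
by rewrite exprS IH -cexpD -natr1; congr cexp; ring.
Qed.

Lemma cabs_wexp z : cabs (wexp z) = expR (- (2 * pi * Im z)).
Proof. by rewrite cabs_cexp complex_ReM /= mul0r sub0r. Qed.

Lemma cos_2pi_eq1 (t : R) : 0 <= t < 1 -> cos (2 * pi * t) = 1 -> t = 0.
Proof.
move=> /andP[t0 t1] cos1; apply/eqP; apply: contraTT t0 => tneq0.
rewrite -ltNge lt_neqAle tneq0 /= leNgt; apply/negP => t0.
have : 0 < sin (pi * t) by apply: sin_gt0_pi; rewrite mulr_gt0 ?pi_gt0//= gtr_pMr ?pi_gt0.
move: cos1; rewrite (_ : 2 * pi * t = (pi * t) *+ 2); last by ring.
rewrite cos_mulr2n cos2sin2 => sin0 sin_gt0.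
have : 0 < sin (pi * t) ^+ 2 by rewrite exprn_gt0.
by move: sin0; rewrite mulr2n; lra.
Qed.

Lemma wexp_eq1 z : wexp z = 1 -> exists n : int, z = n%:~R.
Proof.
move=> wz; have : Im z = 0.
  have := cabs_wexp z; rewrite wz cabs1 -[LHS]expR0 => /expR_inj/eqP.
  by rewrite eq_sym oppr_eq0 mulf_eq0 gt_eqF ?mulr_gt0 ?pi_gt0//= => /eqP.
pose n := Num.floor (Re z); exists n; apply/eqP; rewrite -subr_eq0; set y := z - n%:~R.
have nE : n%:~R = RtoC n%:~R :> CC R by rewrite rmorph_int.
have Imy : Im y = 0 by rewrite /y nE complex_ImB subr0.
have wy : wexp y = 1 by rewrite wexpD wexpN wexp_int wz invr1 mulr1.
have Rey : 0 <= Re y < 1.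
  by rewrite /y nE complex_ReB subr_ge0 ltrBlDl floor_le_tmp -intrD1 floorD1_gt.
have := congr1 Re wy; rewrite /= complex_ReM complex_ImM /= Imy !(mul0r, mulr0) subrr expR0.
rewrite mul1r add0r.
by move=> /(cos_2pi_eq1 Rey) Rey0; apply/eqP/complex_eqP.
Qed.

Lemma unit_circle_polar (x y : R) : x ^+ 2 + y ^+ 2 = 1 -> exists t, cos t = x /\ sin t = y.
Proof.
move=> xy; have x1 : -1 <= x <= 1.
  by rewrite -ler_norml -(@ler_sqr _ _ 1) ?nnegrE// real_normK ?num_real// expr1n -xy lerDl sqr_ge0.
have acosx : cos (acos x) = x by apply: acosK; rewrite in_itv.
have sin_acosx : sin (acos x) = `|y| by rewrite sin_acos// -xy addrC addKr sqrtr_sqr.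
exists (if 0 <= y then acos x else - acos x); case: ifPn => [y0|].
  by rewrite acosx sin_acosx ger0_norm.
by rewrite -ltNge => y0; rewrite cosN sinN acosx sin_acosx ltr0_norm// opprK.
Qed.

Lemma wexp_surj w : w != 0 -> exists z, wexp z = w.
Proof.
move=> w0; have w1 : 0 < cabs w by rewrite cabs_gt0.
have [|t [cost sint]] := @unit_circle_polar (Re w / cabs w) (Im w / cabs w).
  by rewrite !exprMn -mulrDl -sqr_cabs exprVn divff// expf_neq0// gt_eqF.
exists (Complex (ln (cabs w)) t / two_pi_i R); rewrite /wexp mulrC divfK ?two_pi_i_neq0//.
by apply: complex_eqP; rewrite /= lnK ?posrE// ?cost ?sint mulrC divfK// gt_eqF.
Qed.

Lemma is_derive_wexp z : is_derive z 1 wexp (two_pi_i R * wexp z).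
Proof.
have dlin : is_derive z 1 (two_pi_i R \*: id) (two_pi_i R).
  by have := is_deriveZ (two_pi_i R) (is_derive_id z 1); rewrite [_ *: _]mulr1.
by have := is_derive_comp dlin (is_derive_cexp (two_pi_i R * z)); rewrite mulrC.
Qed.

End ComplexExponential.

(** * Mean values and intermediate values of derivatives *)

Section RealDerivative.
Variable R : realType.
Implicit Types (f d : R -> R) (a b s t : R).

Lemma is_derive_MVT f d a b : a < b -> (forall t, a <= t <= b -> is_derive t 1 f (d t)) ->
  exists2 c, a < c < b & f b - f a = d c * (b - a).
Proof.
move=> ab fd; have [t /[!in_itv]/= /andP[/ltW ? /ltW ?]||c] := @MVT R f d a b ab.
- by apply: fd; apply/andP.
- by apply: derivable_within_continuous => t /[!in_itv]/= /fd[].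
by rewrite in_itv /= => ? ?; exists c.
Qed.

Lemma darboux_gt0 f d a b :
  (forall t, a < t < b -> is_derive t 1 f (d t)) -> (forall t, a < t < b -> d t != 0) ->
  forall s t, a < s < b -> a < t < b -> 0 < d s -> 0 < d t.
Proof.
move=> fd d0 s t sab tab ds.
have f_derivable : {in [set` `]a, b[], forall x : R, derivable f x 1}.
  by move=> x /[!inE]/= /[!in_itv]/= /fd[].
have fE x : a < x < b -> f^`()%classic x = d x by move=> /fd[_ <-]; rewrite derive1E.
have f_cont : {within `]a, b[, continuous f}.
  by apply: derivable_within_continuous => x xab; apply: f_derivable; rewrite inE.
have f_neq x y : x \in `]a, b[ -> y \in `]a, b[ -> x < y -> f x != f y.
  rewrite !in_itv /= => /andP[ax _] /andP[_ yb] xy.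
  have [u /andP[xu uy]|c /andP[xc cy] fxy] := is_derive_MVT (f := f) (d := d) xy.
    by apply: fd; rewrite (lt_le_trans ax xu) (le_lt_trans uy yb).
  rewrite eq_sym -subr_eq0 fxy; apply: mulf_neq0; last by rewrite subr_eq0 gt_eqF.
  by rewrite d0// (lt_trans ax xc) (lt_trans cy yb).
have f_inj : {in `]a, b[ &, injective f}.
  move=> x y xab yab fxy; case: (ltgtP x y) => // [xy|yx].
    by have := f_neq x y xab yab xy; rewrite fxy eqxx.
  by have := f_neq y x yab xab yx; rewrite fxy eqxx.
case: (itv_continuous_inj_mono f_cont f_inj) => f_mono.
  by have := incr_derive1_ge0_itv (b0 := false) (b1 := true) f_derivable f_mono tab;
    rewrite fE// lt_neqAle eq_sym d0.
have := decr_derive1_le0_itv (b0 := false) (b1 := true) f_derivable f_mono sab.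
by rewrite fE// leNgt ds.
Qed.

Lemma darboux_gap f d a b (e : R) : 0 < e ->
  (forall t, a < t < b -> is_derive t 1 f (d t)) ->
  (forall t, a < t < b -> d t = 0 \/ e < d t) ->
  forall s t, a < s < b -> a < t < b -> d s = 0 -> d t = 0.
Proof.
move=> e0 fd d_gap s t sab tab ds.
pose f_lin := (e / 2) \*: @id R - f.
have f_lin_d u : a < u < b -> is_derive u 1 f_lin (e / 2 - d u).
  move=> /fd fu; have := is_deriveB (is_deriveZ (e / 2) (is_derive_id u (1 : R))) fu.
  by rewrite [_ *: _]mulr1.
have d_neq u : a < u < b -> e / 2 - d u != 0.
  move=> /d_gap[->|du]; first by rewrite subr0 gt_eqF// divr_gt0.
  by rewrite lt_eqF// subr_lt0; lra.
have := darboux_gt0 f_lin_d d_neq sab tab; rewrite ds subr0 divr_gt0// => /(_ isT).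
by case: (d_gap t tab) => // dt; lra.
Qed.

End RealDerivative.

Section Segments.
Variable R : realType.
Implicit Types (f : CC R -> CC R) (a b x y d : CC R) (t : R).

Definition segment a b : set (CC R) := [set a + RtoC t * (b - a) | t in `[0, 1]].

Lemma segment_refl a b : segment a b b.
Proof. by exists 1; rewrite /= ?in_itv/= ?lexx ?ler01// rmorph1 mul1r addrC subrK. Qed.

Lemma segment_trans a b x y : segment a b x -> segment a x y -> segment a b y.
Proof.
move=> [s /= /[!in_itv]/= /andP[s0 s1] <-] [t /= /[!in_itv]/= /andP[t0 t1] <-].
exists (t * s); first by rewrite /= in_itv /= mulr_ge0// mulr_ile1.
by rewrite rmorphM /=; ring.
Qed.

Lemma cabs_segment a b x : segment a b x -> cabs (x - a) <= cabs (b - a).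
Proof.
move=> [t /= /[!in_itv]/= /andP[t0 t1] <-]; rewrite addrC addKr cabsM cabs_RtoC ger0_norm//.
by rewrite ler_piMl// cabs_ge0.
Qed.

Lemma continuous_line a b : continuous (fun t => a + RtoC t * b).
Proof.
move=> t; apply: cvgD; first exact: cvg_cst.
by apply: (@cvgM (CC R)); [exact: continuous_RtoC|exact: cvg_cst].
Qed.

Lemma is_derive_Re_line f a b d t : is_derive (a + RtoC t * b) 1 f d ->
  is_derive t 1 (fun s : R => Re (f (a + RtoC s * b))) (Re (d * b)).
Proof.
move=> /is_derive_caratheodoryP[g [g_cont <- fE]]; apply/is_derive_caratheodoryP.
exists (fun s => Re (g (a + RtoC s * b) * b)); split=> //.
  have gb_cont : {for t, continuous (fun s => g (a + RtoC s * b) * b)}.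
    apply: (@continuousM (CC R)); last exact: cst_continuous.
    by apply: continuous_comp; [exact: continuous_line|exact: g_cont].
  by apply: continuous_comp; [exact: gb_cont|exact: continuous_Re].
move=> s; rewrite fE complex_ReD; congr (_ + _).
have -> : g (a + RtoC s * b) * (a + RtoC s * b - (a + RtoC t * b)) =
  g (a + RtoC s * b) * b * RtoC (s - t) by rewrite rmorphB; ring.
by rewrite complex_ReM /= mulr0 subr0.
Qed.

Lemma cabs_mean_value f (f' : CC R -> CC R) a b (M : R) :
  (forall x, segment a b x -> is_derive x 1 f (f' x)) ->
  (forall x, segment a b x -> cabs (f' x) <= M) ->
  cabs (f b - f a) <= M * cabs (b - a).
Proof.
move=> fd f'M; have [->|fab] := eqVneq (f b - f a) 0.
  rewrite cabs0 mulr_ge0 ?cabs_ge0//.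
  by apply: le_trans (cabs_ge0 _) (f'M b _); exact: segment_refl.
pose u := (f b - f a)^-1; pose y t := a + RtoC t * (b - a).
have y_seg t : 0 <= t <= 1 -> segment a b (y t) by exists t; rewrite //= in_itv.
have [c c01] := is_derive_MVT ltr01 (fun t t01 =>
  is_derive_Re_line (is_deriveZ u (fd _ (y_seg t t01)))).
rewrite rmorph0 rmorph1 mul0r mul1r addr0 (addrC a) subrK subr0 mulr1 -complex_ReB.
rewrite /= -scalerBr [_ *: _]mulVf// /= => Re1.
have {c01}c01 : 0 <= c <= 1 by case/andP: c01 => /ltW -> /ltW ->.
have : 1 <= cabs (u * f' (y c) * (b - a)).
  by rewrite Re1; apply: le_trans (ler_norm _) _; exact: Re_le_cabs.
rewrite -mulrA cabsM cabsV mulrC ler_pdivlMr ?cabs_gt0// mul1r => /le_trans; apply.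
by rewrite cabsM ler_wpM2r ?cabs_ge0// f'M//; exact: y_seg.
Qed.

End Segments.

(** * Locally constant predicates on the complement of a discrete set *)

Section Codiscrete.
Variable R : realType.
Implicit Types (V T : set (CC R)) (x y z : CC R) (r t : R).

Definition locally_constant_at T z :=
  (\forall x \near z, T x) \/ (\forall x \near z, ~ T x).

Lemma path_locally_constant (gamma : R -> CC R) T : continuous gamma ->
  (forall t, 0 <= t <= 1 -> locally_constant_at T (gamma t)) -> T (gamma 0) -> T (gamma 1).
Proof.
move=> gamma_cont T_loc T0; pose chi t : R := `[< T (gamma t) >]%:R.
have chi0 t : 0 <= t <= 1 -> is_derive t 1 chi 0.
  move=> /T_loc T_gamma; apply: (@near_eq_is_derive _ _ _ (cst (chi t))).
  apply: (gamma_cont t [set u | chi t = `[< T u >]%:R]).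
  case: T_gamma => T_gamma; have Tt := nbhs_singleton T_gamma.
    by apply: filterS T_gamma => u Tu; rewrite /chi /= !asboolT.
  by apply: filterS T_gamma => u Tu; rewrite /chi /= !asboolF.
have [c _] := is_derive_MVT ltr01 chi0.
by rewrite mul0r /chi (asboolT T0) => /eqP; rewrite subr_eq0 eqr_nat; case: asboolP.
Qed.

(* Two points of a punctured disc are joined by the logarithmic spiral
   [z + (x - z) * wexp (t * u)]. *)
Lemma punctured_disc_locally_constant T z r :
  (forall x, x != z -> cabs (x - z) < r -> locally_constant_at T x) ->
  forall x y, x != z -> cabs (x - z) < r -> y != z -> cabs (y - z) < r -> T x -> T y.
Proof.
move=> T_loc x y xz xr yz yr Tx.
have xz0 : x - z != 0 by rewrite subr_eq0.
have [|u uE] := @wexp_surj R ((y - z) / (x - z)); first by rewrite mulf_neq0 ?invr_eq0 ?subr_eq0.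
pose gamma t := z + (x - z) * wexp (RtoC t * u).
have gamma0 : gamma 0 = x by rewrite /gamma rmorph0 mul0r wexp0 mulr1 addrC subrK.
have gamma1 : gamma 1 = y by rewrite /gamma rmorph1 mul1r uE mulrC divfK// addrC subrK.
have gammaz t : cabs (gamma t - z) = cabs (x - z) * expR (- (2 * pi * Im u) * t).
  rewrite /gamma addrC addKr cabsM cabs_wexp complex_ImM /= mul0r addr0.
  by congr (_ * expR _); ring.
rewrite -gamma1; apply: path_locally_constant; last by rewrite gamma0.
  move=> t; apply: cvgD; first exact: cvg_cst.
  apply: (@cvgM (CC R)); first exact: cvg_cst.
  apply: (@continuous_comp _ _ _ (fun t => RtoC t * u)); last first.
    exact: is_derive_continuous (is_derive_wexp _).
  by apply: (@cvgM (CC R)); [exact: continuous_RtoC|exact: cvg_cst].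
move=> t /andP[t0 t1]; apply: T_loc.
  by rewrite -subr_eq0 -cabs_eq0 gammaz mulf_neq0 ?cabs_eq0// gt_eqF ?expR_gt0.
rewrite gammaz; have [u0|u0] := leP 0 (2 * pi * Im u).
  apply: le_lt_trans xr; rewrite ler_piMr ?cabs_ge0// -[leRHS]expR0 ler_expR mulNr oppr_le0.
  by rewrite mulr_ge0.
apply: le_lt_trans yr; rewrite -gamma1 gammaz ler_wpM2l ?cabs_ge0// ler_expR.
by rewrite ler_wpM2l// oppr_ge0 ltW.
Qed.

Definition codiscrete V := forall z, \forall x \near z^', V x.

Lemma codiscrete_near V z : codiscrete V -> V z -> \forall x \near z, V x.
Proof.
move=> Vco Vz; have : nbhs z (fun x => x != z -> V x) by exact: Vco.
by apply: filterS => x Vx; have [->|/Vx] := eqVneq x z.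
Qed.

Lemma codiscrete_locally_constant V T : codiscrete V ->
  (forall z, V z -> locally_constant_at T z) -> forall x y, V x -> V y -> T x -> T y.
Proof.
move=> Vco T_loc x y Vx Vy Tx.
pose T_around z := \forall u \near z^', T u.
have not_around z : (\forall u \near z^', ~ T u) -> ~ T_around z.
  by move=> zNT zT; have [u []] := filter_ex (filterI zNT zT).
have T_around_loc z : locally_constant_at T_around z.
  have /near_punctured_cabsP[r r0 Vr] := Vco z.
  have T_const := punctured_disc_locally_constant (fun u uz ur => T_loc u (Vr u uz ur)).
  have around (P : set (CC R)) : (forall u, u != z -> cabs (u - z) < r -> P u) ->
      \forall u \near z, \forall v \near u^', P v.
    by move=> Pr; apply/near_dnbhs_near/near_punctured_cabsP; exists r.
  have [[u [uz ur Tu]]|noT] := pselect (exists u, [/\ u != z, cabs (u - z) < r & T u]).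
    by left; apply: around => v vz vr; exact: T_const uz ur vz vr Tu.
  right; have : \forall u \near z, \forall v \near u^', ~ T v.
    by apply: around => v vz vr Tv; apply: noT; exists v.
  by apply: filterS => u; exact: not_around.
have Tax : T_around x.
  case: (T_loc x Vx) => [|/nbhs_singleton//]; exact: nbhs_dnbhs.
have Tay : T_around y.
  have := @path_locally_constant (fun t => x + RtoC t * (y - x)) T_around.
  rewrite rmorph0 rmorph1 mul0r mul1r addr0 (addrC x) subrK; apply => //.
  exact: continuous_line.
case: (T_loc y Vy) => [/nbhs_singleton//|yNT].
by case: (not_around y) => //; exact: nbhs_dnbhs.
Qed.

Lemma codiscrete_eq V (f g : CC R -> CC R) : codiscrete V ->
  continuous f -> continuous g -> {in V, f =1 g} -> f =1 g.
Proof.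
move=> Vco fc gc fg z; apply/eqP; apply: contraT => fgz.
have fgx : \forall x \near z^', f x != g x.
  by apply: nbhs_dnbhs; exact: continuous_near_neq (fc z) (gc z) fgz.
have [x [/negP]] := filter_ex (filterI fgx (Vco z)).
by move=> + Vx; rewrite fg ?inE.
Qed.

Lemma near_derive0_constant (f : CC R -> CC R) z :
  (\forall x \near z, is_derive x (1 : CC R) f 0) -> \forall x \near z, f x = f z.
Proof.
move=> /near_cabsP[r r0 fd]; apply/near_cabsP; exists r => // x xr.
apply/eqP; rewrite -subr_eq0 -cabs_eq0 eq_le cabs_ge0 andbT -(mul0r (cabs (x - z))).
apply: (@cabs_mean_value _ _ (fun=> 0)) => y yzx; last by rewrite cabs0.
by apply: fd; exact: le_lt_trans (cabs_segment yzx) xr.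
Qed.

Lemma codiscrete_derive0_constant V (f : CC R -> CC R) : codiscrete V ->
  (forall z, V z -> is_derive z 1 f 0) -> forall x y, V x -> V y -> f y = f x.
Proof.
move=> Vco fd x y Vx Vy; pose T u := f u = f x.
apply: (@codiscrete_locally_constant V T Vco _ x y Vx Vy) => // z Vz.
have /near_derive0_constant fz : \forall u \near z, is_derive u (1 : CC R) f 0.
  by apply: filterS (codiscrete_near Vco Vz) => u; exact: fd.
by have [fzx|fzx] := pselect (f z = f x); [left|right]; apply: filterS fz => u; rewrite /T => ->.
Qed.

End Codiscrete.

(** * Linear differential equations off a discrete set *)

Section LinearODE.
Variable R : realType.
Implicit Types (F dF g k : CC R -> CC R) (a b x z : CC R) (V : set (CC R)).

(* Along a segment issued from [z], the real function [Re (F / (g z * b))] has derivative [0]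
   or at least [1 / 2]; by Darboux's theorem it cannot take both kinds of values. *)
Lemma derivative_dichotomy F dF g z :
  (forall x, is_derive x 1 F (dF x)) -> {for z, continuous g} -> g z != 0 ->
  (\forall x \near z, dF x = 0 \/ dF x = g x) ->
  \forall x \near z, dF x = 0 <-> dF z = 0.
Proof.
move=> Fd g_cont gz0 dF_choice.
have Re_quotient : \forall x \near z, 2^-1 < Re (g x / g z).
  apply: (cvgr_gt _ (continuous_Re_div (w := g z) g_cont)).
  by rewrite divff//= invf_lt1// ltr1n.
have /near_cabsP[r r0 near_r] :
    \forall x \near z, (dF x = 0 \/ dF x = g x) /\ 2^-1 < Re (g x / g z) by exact: filterI.
apply/near_cabsP; exists (r / 2) => [|x xr]; first by rewrite divr_gt0.
have [->//|xz] := eqVneq x z.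
have b0 : x - z != 0 by rewrite subr_eq0.
set b := x - z in xr b0; pose y t := z + RtoC t * b.
pose h t : R := Re ((g z * b)^-1 * F (y t)); pose d t : R := Re (dF (y t) / g z).
have hd (t : R) : is_derive t 1 h (d t).
  have := is_derive_Re_line (is_deriveZ ((g z * b)^-1) (Fd (y t))).
  congr (is_derive _ _ _ (Re _)).
  by rewrite /GRing.scale /=; field; rewrite gz0.
have y_near (t : R) : -2 < t < 2 -> cabs (y t - z) < r.
  rewrite -ltr_norml => t2; rewrite addrC addKr cabsM cabs_RtoC mulrC.
  have : cabs b * `|t| <= cabs b * 2 by rewrite ler_wpM2l ?cabs_ge0// ltW.
  by move: xr; lra.
have dE (t : R) : -2 < t < 2 -> dF (y t) = 0 /\ d t = 0 \/ dF (y t) <> 0 /\ 2^-1 < d t.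
  move=> /y_near/near_r[[dF0|dFE] Re_gt]; [left|right]; rewrite /d; first by rewrite dF0 mul0r.
  split; last by rewrite dFE.
  by move=> dF0; move: Re_gt; rewrite -dFE dF0 mul0r /=; lra.
have d_gap : forall t : R, -2 < t < 2 -> d t = 0 \/ 2^-1 < d t.
  by move=> t /dE[[_ ?]|[_ ?]]; [left|right].
have half0 : 0 < 2^-1 :> R by rewrite invr_gt0.
have i0 : -2 < (0 : R) < 2 by rewrite oppr_lt0 ltr0n.
have i1 : -2 < (1 : R) < 2 by rewrite ltr1n (lt_trans _ ltr01)// oppr_lt0.
have := dE 1 i1; have := dE 0 i0.
rewrite [y 0](_ : _ = z); last by rewrite /y rmorph0 mul0r addr0.
rewrite [y 1](_ : _ = x); last by rewrite /y rmorph1 mul1r addrC subrK.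
have zero_iff := darboux_gap half0 (fun t _ => hd t) d_gap.
move=> [[-> d0]|[dFz d0]] [[-> d1]|[dFx d1]] //; exfalso.
  by move: d1; rewrite (zero_iff _ _ i0 i1 d0); lra.
by move: d0; rewrite (zero_iff _ _ i1 i0 d1); lra.
Qed.

Lemma log_derivative_dichotomy V F dF k : codiscrete V ->
  (forall x, is_derive x 1 F (dF x)) ->
  (forall z, V z -> {for z, continuous k}) -> (forall z, V z -> k z != 0) ->
  (forall z, V z -> dF z = 0 \/ dF z = F z * k z) ->
  (exists z0, F z0 = 0) -> forall z, V z -> dF z = F z * k z.
Proof.
move=> Vco Fd k_cont k0 dF_choice [z0 Fz0] a Va; apply: contrapT => dFa.
have {}dFa0 : dF a = 0 by case: (dF_choice a Va).
have Fa0 : F a != 0 by apply: contra_notN dFa => /eqP ->; rewrite dFa0 mul0r.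
have Fc z : {for z, continuous F} := is_derive_continuous (Fd z).
pose T z := F z = F a /\ dF z = 0.
have T_loc z : V z -> locally_constant_at T z.
  move=> Vz; have [Fza|Fza] := eqVneq (F z) (F a); last first.
    right; have : \forall x \near z, F x != F a.
      by apply: (continuous_near_neq (g := cst (F a))) Fza; [exact: Fc|exact: cst_continuous].
    by apply: filterS => x /eqP Fxa [].
  have iff_near : \forall x \near z, dF x = 0 <-> dF z = 0.
    apply: (@derivative_dichotomy F dF (fun x => F x * k x) z Fd).
    - by apply: (@continuousM (CC R) (CC R)); [exact: Fc|exact: k_cont].
    - by rewrite Fza mulf_neq0// k0.
    - by apply: filterS (codiscrete_near Vco Vz) => x; exact: dF_choice.
  have [dFz|dFz] := pselect (dF z = 0); last first.
    by right; apply: filterS iff_near => x xz [_ /xz].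
  have dF_near : \forall x \near z, dF x = 0 by apply: filterS iff_near => x [_]; exact.
  left; have /near_derive0_constant F_near : \forall x \near z, is_derive x (1 : CC R) F 0.
    by apply: filterS dF_near => x dFx; have := Fd x; rewrite dFx.
  by apply: filterS2 dF_near F_near => x dFx Fxz; rewrite /T Fxz.
have TV z : V z -> T z.
  by move=> Vz; apply: (codiscrete_locally_constant Vco T_loc Va Vz); split.
have FE : F =1 (fun=> F a).
  apply: (codiscrete_eq Vco) => [z|z|z]; [exact: Fc|exact: cst_continuous|].
  by rewrite inE => /TV[].
by move: Fa0; rewrite -(FE z0) Fz0 eqxx.
Qed.

Lemma compact_segment a b : compact (segment a b).
Proof.
apply: continuous_compact; last exact: segment_compact.
by apply: continuous_subspaceT; exact: continuous_line.
Qed.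

Lemma cabs_growth F dF a b (K : R) : 0 <= K <= 2^-1 ->
  (forall x, segment a b x -> is_derive x 1 F (dF x)) ->
  (forall x, segment a b x -> cabs (dF x) * cabs (b - a) <= K * cabs (F x)) ->
  cabs (F b - F a) <= 2 * K * cabs (F a).
Proof.
move=> /andP[K0 K2] Fd dFK; have [->|ab] := eqVneq b a.
  by rewrite subrr cabs0 !mulr_ge0 ?cabs_ge0.
have ab0 : 0 < cabs (b - a) by rewrite cabs_gt0 subr_eq0.
have absF_cont : {within segment a b, continuous (fun x => cabs (F x))}.
  apply: continuous_in_subspaceT => x /[!inE] /Fd Fx.
  exact: continuous_cabs_comp (is_derive_continuous Fx).
have [c /[!inE] abc F_max] := compact_EVT_max (ex_intro _ _ (segment_refl a b))
  (@compact_segment a b) absF_cont.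
pose M := cabs (F c).
have F_near_a x : segment a b x -> cabs (F x - F a) <= K * M.
  move=> abx; have sub y : segment a x y -> segment a b y by exact: segment_trans.
  apply: le_trans (cabs_mean_value (f' := dF) (M := K * M / cabs (b - a)) _ _) _.
  - by move=> y /sub; exact: Fd.
  - move=> y /sub aby; rewrite ler_pdivlMr//; apply: le_trans (dFK y aby) _.
    by rewrite ler_wpM2l// F_max// inE.
  - by rewrite -mulrA ler_piMr ?mulr_ge0 ?cabs_ge0// ler_pdivrMl// mulr1 cabs_segment.
have M2 : M <= 2 * cabs (F a).
  have := F_near_a c abc; have := cabsB_ge (F c) (F a); rewrite -/M.
  have : K * M <= 2^-1 * M by rewrite ler_wpM2r// cabs_ge0.
  lra.
apply: le_trans (F_near_a b (segment_refl a b)) _.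
by rewrite -mulrA mulrCA ler_wpM2l.
Qed.

Lemma linear_ode_zero_near F dF k z : (forall x, is_derive x 1 F (dF x)) ->
  {for z, continuous k} -> F z = 0 -> (\forall x \near z, dF x = F x * k x) ->
  \forall x \near z, F x = 0.
Proof.
move=> Fd k_cont Fz ode; pose K := cabs (k z) + 1.
have K0 : 0 < K by rewrite ltr_wpDl// cabs_ge0.
have kK : \forall x \near z, cabs (k x) < K.
  by apply: (cvgr_lt _ (continuous_cabs_comp k_cont)); rewrite ltrDl.
have /near_cabsP[r r0 near_r] : \forall x \near z, dF x = F x * k x /\ cabs (k x) < K.
  exact: filterI.
apply/near_cabsP; exists (Num.min r (2 * K)^-1).
  by rewrite lt_min r0 invr_gt0 mulr_gt0.
move=> x; rewrite lt_min => /andP[xr xK].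
have := @cabs_growth F dF z x (K * cabs (x - z)).
rewrite Fz subr0 cabs0 mulr0 => F_le0; apply/eqP.
rewrite -cabs_eq0 eq_le cabs_ge0 andbT; apply: F_le0 => [|y zxy].
  by rewrite mulr_ge0 ?cabs_ge0 ?(ltW K0)//= -ler_pdivlMl// -invfM mulrC ltW.
have [-> ky] := near_r y (le_lt_trans (cabs_segment zxy) xr).
by rewrite cabsM [leRHS]mulrC mulrA ler_wpM2r ?cabs_ge0// ler_wpM2l ?cabs_ge0// ltW.
Qed.

Lemma linear_ode_neq0 V F dF k : codiscrete V -> (forall x, is_derive x 1 F (dF x)) ->
  (forall z, V z -> {for z, continuous k}) -> (forall z, V z -> dF z = F z * k z) ->
  (exists z1, F z1 != 0) -> forall z, V z -> F z != 0.
Proof.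
move=> Vco Fd k_cont ode [z1 Fz1] z Vz; apply/eqP => Fz.
have Fc x : {for x, continuous F} := is_derive_continuous (Fd x).
have zero_loc x : V x -> locally_constant_at (fun y => F y = 0) x.
  move=> Vx; have [Fx|Fx] := eqVneq (F x) 0.
    left; apply: (linear_ode_zero_near Fd (k_cont x Vx) Fx).
    by apply: filterS (codiscrete_near Vco Vx) => y; exact: ode.
  by right; apply: filterS (cvgr_neq0 _ (Fc x) Fx) => y /eqP.
have FE : F =1 (fun=> 0).
  apply: (codiscrete_eq Vco) => [x|x|x]; [exact: Fc|exact: cst_continuous|].
  by rewrite inE => Vx; exact: (codiscrete_locally_constant (T := fun y => F y = 0) Vco) Vz Vx Fz.
by move: Fz1; rewrite FE eqxx.
Qed.

Lemma linear_ode_proportional V F dF (G dG : CC R -> CC R) k : codiscrete V ->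
  (forall x, is_derive x 1 F (dF x)) -> (forall x, is_derive x 1 G (dG x)) ->
  (forall z, V z -> G z != 0) ->
  (forall z, V z -> dF z = F z * k z) -> (forall z, V z -> dG z = G z * k z) ->
  exists a, F =1 fun z => a * G z.
Proof.
move=> Vco Fd Gd G0 F_ode G_ode; have [z0 Vz0] := filter_ex (Vco 0).
exists (F z0 / G z0); apply: (codiscrete_eq Vco) => [z|z|z].
- exact: is_derive_continuous (Fd z).
- exact: is_derive_continuous (is_deriveZ (F z0 / G z0) (Gd z)).
rewrite inE => Vz; have quot_const : F z / G z = F z0 / G z0.
  apply: (codiscrete_derive0_constant (f := fun x => F x / G x) Vco) Vz0 Vz => x Vx.
  have := is_deriveM (Fd x) (is_derive_invr (G0 x Vx) (Gd x)).
  congr (is_derive _ _ _ _); rewrite F_ode// G_ode// /GRing.scale /=.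
  by field; exact: G0.
by rewrite -quot_const divfK// G0.
Qed.

End LinearODE.

(** * Order of vanishing *)

Section VanishingOrder.
Variable K : numFieldType.
Implicit Types (f g : K -> K) (x z d : K) (j : nat).

Definition vanishing_order f z j g :=
  [/\ {for z, continuous g}, g z != 0 & forall x, f x = (x - z) ^+ j * g x].

Definition finite_order f z := exists j g, vanishing_order f z j g.

Lemma finite_order_neq0 f z : {for z, continuous f} -> f z != 0 -> finite_order f z.
Proof. by move=> fc fz; exists 0%N, f; split=> // x; rewrite mul1r. Qed.

Lemma finite_orderM f g z :
  finite_order f z -> finite_order g z -> finite_order (fun x => f x * g x) z.
Proof.
move=> [j [f' [f'c f'z fE]]] [i [g' [g'c g'z gE]]]; exists (j + i)%N, (fun x => f' x * g' x).
by split=> [||x]; [exact: (@continuousM K K)|rewrite mulf_neq0|rewrite fE gE exprD mulrACA].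
Qed.

Lemma finite_order_near_neq0 f z : finite_order f z -> \forall x \near z^', f x != 0.
Proof.
move=> [j [g [gc gz fE]]].
have gx_neq0 : \forall x \near z^', g x != 0 by exact: nbhs_dnbhs (cvgr_neq0 _ gc gz).
apply: filterS2 (nbhs_dnbhs_neq z) gx_neq0 => x xz gx.
by rewrite fE mulf_neq0 ?expf_neq0 ?subr_eq0.
Qed.

Lemma vanishing_order1_derive f g z d :
  vanishing_order f z 1 g -> is_derive z 1 f d -> d = g z.
Proof.
move=> [gc _ fE] fd; apply: is_derive_unique fd _; apply/is_derive_caratheodoryP.
by exists g; split=> // x; rewrite !fE subrr mul0r add0r mulrC.
Qed.

End VanishingOrder.

Section VanishingOrderPrimitive.
Variable R : realType.
Implicit Types (f df g : CC R -> CC R) (x z lam : CC R) (j : nat).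

Lemma primitive_near_le f df z j :
  (forall x, is_derive x 1 f (df x)) -> f z = 0 ->
  (forall e : R, 0 < e -> \forall x \near z, cabs (df x) <= e * cabs (x - z) ^+ j) ->
  forall e : R, 0 < e -> \forall x \near z, cabs (f x) <= e * cabs (x - z) ^+ j.+1.
Proof.
move=> fd fz df_le e e0; have /near_cabsP[r r0 near_r] := df_le e e0.
apply/near_cabsP; exists r => // x xr; rewrite -[f x]subr0 -fz exprSr mulrA.
apply: (cabs_mean_value (f' := df)) => // y zxy.
apply: le_trans (near_r y (le_lt_trans (cabs_segment zxy) xr)) _.
by rewrite ler_pM2l// lerXn2r ?nnegrE ?cabs_ge0// cabs_segment.
Qed.

Lemma is_derive_shiftX z x j :
  is_derive x 1 (fun y => (y - z) ^+ j.+1) (j.+1%:R * (x - z) ^+ j).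
Proof.
have := is_derive_horner (('X - z%:P) ^+ j.+1) x.
have -> : horner (('X - z%:P) ^+ j.+1) = fun y => (y - z) ^+ j.+1.
  by apply/funext => y; rewrite !hornerE.
by rewrite deriv_exp derivXsubC mul1r -mulr_natl !hornerE /= hornerMn hornerC.
Qed.

Lemma vanishing_order_primitive f df g z j :
  (forall x, is_derive x 1 f (df x)) -> f z = 0 -> vanishing_order df z j g ->
  exists h, vanishing_order f z j.+1 h.
Proof.
move=> fd fz [gc gz dfE]; have j0 : j.+1%:R != 0 :> CC R by rewrite pnatr_eq0.
pose rem x := f x - g z / j.+1%:R * (x - z) ^+ j.+1.
have rem_d x : is_derive x 1 rem ((x - z) ^+ j * (g x - g z)).
  have := is_deriveB (fd x) (is_deriveZ (g z / j.+1%:R) (is_derive_shiftX z x j)).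
  by congr (is_derive _ _ _ _); rewrite dfE /GRing.scale /=; field.
have rem0 : rem z = 0 by rewrite /rem fz subrr expr0n mulr0 subrr.
have rem_le := primitive_near_le (j := j) rem_d rem0 _.
exists (fun x => if x == z then g z / j.+1%:R else f x / (x - z) ^+ j.+1); split.
- apply/continuous_cabsP => e e0; rewrite eqxx.
  have e20 : 0 < e / 2 by rewrite divr_gt0.
  apply: filterS (rem_le _ _ e20) => [x|e' e'0]; last first.
    have /continuous_cabsP/(_ e' e'0) := gc; apply: filterS => x gx.
    by rewrite cabsM cabsX mulrC ler_wpM2r ?exprn_ge0 ?cabs_ge0// ltW.
  case: eqVneq => [_ _|xz]; first by rewrite subrr cabs0.
  have xz0 : x - z != 0 by rewrite subr_eq0.
  rewrite -ler_pdivrMr ?exprn_gt0 ?cabs_gt0// -cabsX -cabsV -cabsM /rem mulrBl mulfK ?expf_neq0//.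
  by move=> /le_lt_trans; apply; rewrite ltr_pdivrMr// ltr_pMr// ltr1n.
- by rewrite eqxx mulf_neq0 ?invr_eq0.
- move=> x; case: eqVneq => [->|xz]; first by rewrite subrr expr0n mul0r.
  by rewrite mulrC divfK// expf_neq0// subr_eq0.
Qed.

Lemma finite_order_primitive f df z :
  (forall x, is_derive x 1 f (df x)) -> finite_order df z -> finite_order f z.
Proof.
move=> fd [j [g dfj]]; have [fz|fz] := eqVneq (f z) 0.
  by have [h fh] := vanishing_order_primitive fd fz dfj; exists j.+1, h.
by apply: finite_order_neq0 fz; exact: is_derive_continuous (fd z).
Qed.

Lemma is_derive_cexpZ lam x :
  is_derive x 1 (fun y => cexp (lam * y)) (lam * cexp (lam * x)).
Proof.
have dlin := is_deriveZ lam (is_derive_id x (1 : CC R)).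
have := is_derive_comp dlin (is_derive_cexp (lam * x)).
by congr (is_derive _ _ _ _); rewrite /GRing.scale /= mulr1 mulrC.
Qed.

(* [e^(- lam x) f] has derivative [e^(- lam x) (f' - lam f)]. *)
Lemma finite_order_twist f df lam z : (forall x, is_derive x 1 f (df x)) ->
  finite_order (fun x => df x - lam * f x) z -> finite_order f z.
Proof.
move=> fd df_fin.
have cexp_fin mu : finite_order (fun y => cexp (mu * y)) z.
  by apply: finite_order_neq0; [exact: is_derive_continuous (is_derive_cexpZ _ _)|
    exact: cexp_neq0].
have fE : f = fun x => cexp (lam * x) * (cexp (- lam * x) * f x).
  by apply/funext => x; rewrite mulrA -cexpD mulNr subrr cexp0 mul1r.
rewrite fE; apply: finite_orderM (cexp_fin lam) _.
apply: (@finite_order_primitive _ (fun x => cexp (- lam * x) * (df x - lam * f x))).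
  move=> x; have := is_deriveM (is_derive_cexpZ (- lam) x) (fd x).
  by congr (is_derive _ _ _ _); rewrite /GRing.scale /=; ring.
exact: finite_orderM (cexp_fin _) df_fin.
Qed.

End VanishingOrderPrimitive.

(** * Polynomials in [z] and [e^(2 pi i z)] *)

Lemma deriv_addZ_eq0 (K : numFieldType) (p : {poly K}) (c : K) :
  c != 0 -> p^`() + c *: p = 0 -> p = 0.
Proof.
move=> c0 /eqP; rewrite addr_eq0 => /eqP p'E; apply/eqP; apply: contraT => p0.
by have := lt_size_deriv p0; rewrite p'E size_polyN size_scale// ltnn.
Qed.

Lemma deriv_eq0_size_le1 (K : numFieldType) (p : {poly K}) : p^`() = 0 -> (size p <= 1)%N.
Proof.
move=> p'0; apply/leq_sizeP => -[//|i] _; have := coef_deriv p i.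
by rewrite p'0 coef0 => /esym/eqP; rewrite mulrn_eq0 => /eqP.
Qed.

Section ExponentialPolynomial.
Variable R : realType.
Implicit Types (A : {poly CC R}) (P : {poly {poly CC R}}) (x z lam : CC R).

Definition exp_poly P x := P.[(wexp x)%:P].[x].

Lemma exp_poly_sum n P x : (size P <= n)%N ->
  exp_poly P x = \sum_(i < n) (P`_i).[x] * wexp x ^+ i.
Proof.
move=> Pn; rewrite /exp_poly (horner_coef_wide _ Pn) horner_sum; apply: eq_bigr => i _.
by rewrite hornerM horner_exp hornerC.
Qed.

Lemma exp_poly_map A x : exp_poly (map_poly polyC A) x = A.[wexp x].
Proof. by rewrite /exp_poly horner_map hornerC. Qed.

(* The function [f] given by [P] is sent to [f' - lam f]. *)
Definition exp_twist lam P : {poly {poly CC R}} :=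
  \poly_(i < size P) ((P`_i)^`() + (two_pi_i R * i%:R - lam) *: P`_i).

Lemma coef_exp_twist lam P i :
  (exp_twist lam P)`_i = (P`_i)^`() + (two_pi_i R * i%:R - lam) *: P`_i.
Proof.
by rewrite coef_poly; case: ltnP => // Pi; rewrite nth_default// deriv0 scaler0 addr0.
Qed.

Lemma is_derive_wexpX i x :
  is_derive x 1 (fun y => wexp y ^+ i) (two_pi_i R * i%:R * wexp x ^+ i).
Proof.
have wexpE y : wexp y ^+ i = cexp (two_pi_i R * i%:R * y) by exact: wexpXz y i.
by rewrite wexpE (_ : (fun y => wexp y ^+ i) = fun y => cexp (two_pi_i R * i%:R * y));
  [exact: is_derive_cexpZ|exact/funext].
Qed.

Lemma is_derive_exp_poly lam P x :
  is_derive x 1 (exp_poly P) (exp_poly (exp_twist lam P) x + lam * exp_poly P x).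
Proof.
have expE : exp_poly P = \sum_(i < size P) (horner P`_i * (fun y => wexp y ^+ i)).
  by apply/funext => y; rewrite fct_sumE (exp_poly_sum y (leqnn _)).
rewrite [X in is_derive _ _ X]expE; apply: is_derive_eq.
  apply: is_derive_sum => i; apply: is_deriveM; [exact: is_derive_horner|exact: is_derive_wexpX].
rewrite (exp_poly_sum x (size_poly _ _)) (exp_poly_sum x (leqnn _)) mulr_sumr -big_split.
apply: eq_bigr => i _ /=; rewrite coef_exp_twist; move: (P`_i) => p.
by rewrite hornerD hornerZ /GRing.scale /=; ring.
Qed.

Lemma continuous_exp_poly P : continuous (exp_poly P).
Proof. by move=> x; exact: is_derive_continuous (is_derive_exp_poly 0 P x). Qed.

Lemma exp_poly_finite_order P z : P != 0 -> finite_order (exp_poly P) z.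
Proof.
suff fin n s (Q : {poly {poly CC R}}) : (size Q <= n)%N -> (size (Q`_n.-1)%R <= s)%N -> Q != 0 ->
  finite_order (exp_poly Q) z by exact: fin (leqnn _) (leqnn _).
elim: n s Q => [|n IHn] s Q; first by rewrite leqn0 size_poly_eq0 => /eqP -> _ /eqP.
elim: s Q => [|s IHs] Q Qn Qns Q0.
  apply: (IHn _ _ _ (leqnn _) Q0); apply/leq_sizeP => i; rewrite leq_eqVlt => /predU1P[<-|ni].
    by apply/eqP; rewrite -size_poly_leq0.
  by rewrite nth_default// (leq_trans Qn).
pose lam := two_pi_i R * n%:R; have [twist0|twist_neq0] := eqVneq (exp_twist lam Q) 0; last first.
  apply: (@finite_order_twist _ _ (fun x => exp_poly (exp_twist lam Q) x + lam * exp_poly Q x) lam).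
    exact: is_derive_exp_poly.
  rewrite (_ : (fun x => _) = exp_poly (exp_twist lam Q)); last first.
    by apply/funext => x; rewrite addrK.
  apply: IHs => //; first exact: leq_trans (size_poly _ _) Qn.
  rewrite coef_exp_twist subrr scale0r addr0; have [->|Qn0] := eqVneq (Q`_n) 0.
    by rewrite deriv0 size_poly0.
  by rewrite -ltnS (leq_trans (lt_size_deriv Qn0)).
have Q_coef0 i : i != n -> Q`_i = 0.
  move=> i_n; apply: (@deriv_addZ_eq0 _ _ (two_pi_i R * i%:R - lam)).
    by rewrite -mulrBr mulf_neq0 ?two_pi_i_neq0// subr_eq0 eqr_nat.
  by rewrite -coef_exp_twist twist0 coef0.
have [a QnE] : exists a, Q`_n = a%:P.
  have : (Q`_n)^`() = 0 by rewrite -[RHS](coef0 _ n) -twist0 coef_exp_twist subrr scale0r addr0.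
  by move=> /deriv_eq0_size_le1/size1_polyC ->; exists (Q`_n)`_0.
have expE x : exp_poly Q x = a * wexp x ^+ n.
  rewrite (exp_poly_sum x Qn) big_ord_recr /= QnE hornerC big1 ?add0r// => i _.
  by rewrite Q_coef0 ?horner0 ?mul0r// ltn_eqF.
apply: finite_order_neq0 (@continuous_exp_poly Q z) _.
rewrite expE mulf_neq0 ?expf_neq0 ?wexp_neq0//; apply: contraNneq Q0 => a0.
apply/eqP/polyP => i; rewrite coef0.
by have [->|/Q_coef0//] := eqVneq i n; rewrite QnE a0.
Qed.

End ExponentialPolynomial.

(** * Residues of logarithmic derivatives *)

Section Residue.
Variable R : realType.
Implicit Types (F dF G H psi : CC R -> CC R) (a b d x z u v : CC R) (j : nat) (r s t : R).

Lemma is_derive_sqr_cabs_line F a b d t : is_derive (a + RtoC t * b) 1 F d ->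
  let v := F (a + RtoC t * b) in
  is_derive t 1 (fun s => cabs (F (a + RtoC s * b)) ^+ 2)
    (2 * (Re v * Re (d * b) + Im v * Im (d * b))).
Proof.
move=> Fd v; pose mi : CC R := Complex 0 (-1).
have Re_mi y : Re (mi * y) = Im y by rewrite complex_ReM /=; ring.
have ReF := is_derive_Re_line Fd; have ImF := is_derive_Re_line (is_deriveZ mi Fd).
have -> : (fun s => cabs (F (a + RtoC s * b)) ^+ 2) =
    (fun s => Re (F (a + RtoC s * b))) ^+ 2 + (fun s => Re ((mi \*: F) (a + RtoC s * b))) ^+ 2.
  by apply/funext => s; rewrite sqr_cabs -[Im _]Re_mi.
have := is_deriveD (@is_deriveX _ _ _ 2 _ _ _ ReF) (@is_deriveX _ _ _ 2 _ _ _ ImF).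
congr (is_derive _ _ _ _); rewrite /GRing.scale /= /GRing.scale /= -[mi * d * b]mulrA !Re_mi -/v.
ring.
Qed.

(* The function [s |F (z + s u)|^2] vanishes at [s = 0] and is positive afterwards, so its
   derivative [|F|^2 (1 + 2 s Re (u F' / F))] is positive somewhere on [[0, t]]. *)
Lemma ray_log_derivative_gt F dF z u t : (forall x, is_derive x 1 F (dF x)) -> 0 < t ->
  (forall s, 0 < s <= t -> F (z + RtoC s * u) != 0) ->
  exists2 s, 0 < s <= t & - 2^-1 < s * Re (dF (z + RtoC s * u) * u / F (z + RtoC s * u)).
Proof.
move=> Fd t0; set y := fun s => z + RtoC s * u => F_neq0.
pose phi s := s * cabs (F (y s)) ^+ 2.
pose dphi s := s * (2 * (Re (F (y s)) * Re (dF (y s) * u) + Im (F (y s)) * Im (dF (y s) * u)))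
  + cabs (F (y s)) ^+ 2.
have phi_d s : is_derive s 1 phi (dphi s).
  have := is_deriveM (is_derive_id s (1 : R)) (is_derive_sqr_cabs_line (Fd (y s))).
  by congr (is_derive _ _ _ _); rewrite /GRing.scale /= mulr1.
have [c /andP[c0 ct]] := is_derive_MVT t0 (fun s _ => phi_d s).
rewrite {2}/phi mul0r !subr0 => phi_t; have ct0 : 0 < c <= t by rewrite c0 ltW.
exists c => //; have Fc := F_neq0 c ct0.
have : 0 < dphi c.
  by rewrite -(pmulr_lgt0 _ t0) -phi_t mulr_gt0 ?exprn_gt0 ?cabs_gt0 ?F_neq0// t0 lexx.
set m := dF (y c) * u / F (y c).
have -> : dphi c = cabs (F (y c)) ^+ 2 * (1 + 2 * (c * Re m)).
  have dFE : dF (y c) * u = F (y c) * m by rewrite [RHS]mulrC divfK.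
  by rewrite /dphi sqr_cabs dFE complex_ReM complex_ImM; ring.
by rewrite pmulr_rgt0 ?exprn_gt0 ?cabs_gt0//; lra.
Qed.

Lemma log_derivative_ray F dF psi z u j : (forall x, is_derive x 1 F (dF x)) ->
  (\forall x \near z^', F x != 0) ->
  (\forall x \near z^', dF x * (x - z) ^+ j.+1 = F x * psi x) ->
  {for z, continuous psi} -> u != 0 -> - 2^-1 <= Re (psi z / u ^+ j).
Proof.
move=> Fd F_neq0 ode psi_cont u0; rewrite leNgt; apply/negP => Re_lt.
have Re_near : \forall x \near z, Re (psi x / u ^+ j) < - 2^-1.
  exact: (cvgr_lt _ (continuous_Re_div psi_cont)).
have near_z : \forall x \near z^',
    [/\ F x != 0, dF x * (x - z) ^+ j.+1 = F x * psi x & Re (psi x / u ^+ j) < - 2^-1].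
  by apply: filterS3 F_neq0 ode (nbhs_dnbhs Re_near) => x.
have [t /andP[t0 t1] near_t] := near_ray near_z u0.
have [|s s0t] := ray_log_derivative_gt Fd t0 (z := z) (u := u); first by move=> s /near_t[].
have [s0 st] := andP s0t; have [Fy odey Re_y] := near_t s s0t; set y := z + _ in Fy odey Re_y *.
have sC : RtoC s != 0 by rewrite RtoC_eq0 gt_eqF.
have -> : dF y * u / F y = RtoC (s ^- j.+1) * (psi y / u ^+ j).
  move: odey; rewrite addrC addKr exprMn (exprS u) => odey.
  apply: (mulIf Fy); rewrite divfK//; apply: (mulIf (expf_neq0 j.+1 sC)).
  apply: (mulIf (expf_neq0 j u0)); rewrite fmorphV rmorphXn /=.
  transitivity (F y * psi y); first by rewrite -odey; ring.
  set S := RtoC s ^+ j.+1; have S0 : S != 0 by exact: expf_neq0.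
  by set U := u ^+ j; have U0 : U != 0 by [exact: expf_neq0]; field; rewrite S0 U0.
have sj : 1 <= s ^- j by rewrite invf_ge1 ?exprn_gt0// exprn_ile1 ?(le_trans st)// ltW.
rewrite complex_ReM /= mul0r subr0 mulrA exprS invfM mulVKf ?gt_eqF//.
by move: Re_y sj; nra.
Qed.

Lemma log_derivative_simple_pole F dF psi z j : (forall x, is_derive x 1 F (dF x)) ->
  (\forall x \near z^', F x != 0) ->
  (\forall x \near z^', dF x * (x - z) ^+ j.+1 = F x * psi x) ->
  {for z, continuous psi} -> psi z != 0 -> j = 0%N.
Proof.
move=> Fd F_neq0 ode psi_cont psi0; case: j ode => // j ode.
pose u := j.+1.-root (- psi z); have uE : u ^+ j.+1 = - psi z by rewrite rootCK.
have u0 : u != 0 by rewrite rootC_eq0// oppr_eq0.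
have := log_derivative_ray Fd F_neq0 ode psi_cont u0.
by rewrite uE invrN mulrN divff//= lerN2 invf_ge1// lern1.
Qed.

(* Along the circle, the function [F * e^(- 2 pi i t psi z)] of the angle [2 pi t] is almost
   constant, whereas [F] returns to its initial value. *)
Lemma log_derivative_circle F dF psi z rho eta : (forall x, is_derive x 1 F (dF x)) ->
  0 < rho -> 0 <= 4 * pi * eta <= 1 ->
  (forall x, cabs (x - z) = rho ->
    [/\ F x != 0, dF x * (x - z) = F x * psi x & cabs (psi x - psi z) <= eta]) ->
  cabs (wexp (- psi z) - 1) <= 4 * pi * eta.
Proof.
move=> Fd rho0 /andP[eta0 eta1] on_circle; pose beta := - psi z.
pose x v := z + RtoC rho * wexp v.
have xz v : x v - z = RtoC rho * wexp v by rewrite /x addrC addKr.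
have on_x v : Im v = 0 -> [/\ F (x v) != 0,
    dF (x v) * (x v - z) = F (x v) * psi (x v) & cabs (psi (x v) - psi z) <= eta].
  move=> v_real; apply: on_circle.
  by rewrite xz cabsM cabs_RtoC cabs_wexp v_real mulr0 oppr0 expR0 mulr1 gtr0_norm.
pose delta v := F (x v) * wexp (beta * v).
pose ddelta v := two_pi_i R * (psi (x v) + beta) * delta v.
have delta_d v : Im v = 0 -> is_derive v 1 delta (ddelta v).
  move=> /on_x[_ odev _].
  have dx : is_derive v 1 x (RtoC rho * (two_pi_i R * wexp v)).
    have := is_deriveD (is_derive_cst z v 1) (is_deriveZ (RtoC rho) (is_derive_wexp v)).
    by rewrite add0r.
  have := is_deriveM (is_derive_comp dx (Fd (x v)))
    (is_derive_comp (is_deriveZ beta (is_derive_id v (1 : CC R))) (is_derive_wexp (beta * v))).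
  congr (is_derive _ _ _ _); rewrite /GRing.scale /= mulr1.
  have -> : dF (x v) * (RtoC rho * (two_pi_i R * wexp v)) =
    two_pi_i R * (F (x v) * psi (x v)) by rewrite -odev xz; ring.
  by rewrite /ddelta /delta; ring.
have seg_real v : segment 0 1 v -> Im v = 0.
  by move=> [t _ <-]; rewrite add0r subr0 mulr1.
have growth : cabs (delta 1 - delta 0) <= 2 * (2 * pi * eta) * cabs (delta 0).
  apply: (@cabs_growth _ _ ddelta) => [|v|v]; first by apply/andP; split; lra.
    by move=> /seg_real; exact: delta_d.
  move=> /seg_real/on_x[_ _ psi_v]; rewrite subr0 cabs1 mulr1 !cabsM cabs_two_pi_i.
  apply: ler_wpM2r; first by rewrite mulr_ge0 ?cabs_ge0.
  by rewrite ler_wpM2l ?mulr_ge0 ?pi_ge0.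
have x1 : x 1 = x 0 by rewrite /x wexp0 wexp1.
have [F0 _ _] := on_x 0 erefl; have {}F0 : 0 < cabs (F (x 0)) by rewrite cabs_gt0.
move: growth; rewrite /delta mulr1 mulr0 wexp0 mulr1 x1 -{2}[F (x 0)]mulr1 -mulrBr cabsM.
by rewrite mulrC ler_pM2r// => /le_trans; apply; lra.
Qed.

Lemma log_derivative_monodromy F dF psi z : (forall x, is_derive x 1 F (dF x)) ->
  (\forall x \near z^', F x != 0) -> (\forall x \near z^', dF x * (x - z) = F x * psi x) ->
  {for z, continuous psi} -> wexp (psi z) = 1.
Proof.
move=> Fd F_neq0 ode psi_cont.
have pi4 : 0 < 4 * pi :> R by rewrite mulr_gt0 ?pi_gt0.
suff : wexp (- psi z) = 1 by rewrite wexpN => /(congr1 GRing.inv); rewrite invrK invr1.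
apply/eqP; rewrite -subr_eq0 -cabs_eq0 eq_le cabs_ge0 andbT; apply/ler_addgt0Pr => e e0.
pose eta := Num.min 1 e / (4 * pi).
have etaE : 4 * pi * eta = Num.min 1 e by rewrite mulrC divfK// gt_eqF.
have eta0 : 0 < eta by rewrite divr_gt0// lt_min ltr01.
have /continuous_cabsP/(_ eta eta0) psi_near := psi_cont.
have /near_punctured_cabsP[r r0 near_r] : \forall x \near z^',
    [/\ F x != 0, dF x * (x - z) = F x * psi x & cabs (psi x - psi z) < eta].
  by apply: filterS3 F_neq0 ode (nbhs_dnbhs psi_near) => x.
have r20 : 0 < r / 2 by rewrite divr_gt0.
rewrite add0r; apply: (@le_trans _ _ (4 * pi * eta)); last by rewrite etaE ge_min lexx orbT.
apply: (log_derivative_circle Fd r20) => [|x xr].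
  by rewrite etaE le_min ler01 (ltW e0) ge_min lexx.
have xz : x != z by rewrite -subr_eq0 -cabs_eq0 xr gt_eqF.
have xr_lt : cabs (x - z) < r by rewrite xr ltr_pdivrMr// ltr_pMr// ltr1n.
by have [? ? /ltW ?] := near_r x xz xr_lt; split.
Qed.

Lemma log_derivative_residue F dF G H z d : (forall x, is_derive x 1 F (dF x)) ->
  (\forall x \near z^', F x != 0) -> (\forall x \near z^', dF x * H x = F x * G x) ->
  {for z, continuous G} -> G z != 0 -> finite_order H z -> H z = 0 -> is_derive z 1 H d ->
  exists n : nat, G z = n.+1%:R * d.
Proof.
move=> Fd F_neq0 ode G_cont Gz [j [h [h_cont hz HE]]] Hz Hd.
case: j HE => [|j] HE; first by move: hz; rewrite -[h z]mul1r -(expr0 (z - z)) -HE Hz eqxx.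
pose psi x := G x / h x.
have psi_cont : {for z, continuous psi}.
  by apply: (@continuousM (CC R) (CC R)); [exact: G_cont|exact: (@continuousV (CC R))].
have psi0 : psi z != 0 by rewrite mulf_neq0 ?invr_eq0.
have ode_psi : \forall x \near z^', dF x * (x - z) ^+ j.+1 = F x * psi x.
  have h_near : \forall x \near z^', h x != 0 by exact: nbhs_dnbhs (cvgr_neq0 _ h_cont hz).
  apply: filterS2 ode h_near => x odex hx.
  by apply: (mulIf hx); rewrite -mulrA -HE odex mulrA divfK.
have j0 := log_derivative_simple_pole Fd F_neq0 ode_psi psi_cont psi0.
rewrite j0 in HE ode_psi.
have [n psiE] : exists n : int, psi z = n%:~R.
  by apply/wexp_eq1/(log_derivative_monodromy Fd F_neq0 _ psi_cont).
have Re_psi := log_derivative_ray Fd F_neq0 ode_psi psi_cont (oner_neq0 _).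
rewrite divr1 in Re_psi; case: n psiE => [[|n]|n] psiE.
- by rewrite psiE eqxx in psi0.
- exists n; have -> : d = h z by apply: (vanishing_order1_derive _ Hd); split.
  by rewrite -[LHS](divfK hz) -/(psi z) psiE.
- have : (1 : R) <= n.+1%:R by rewrite ler1n.
  by move: Re_psi; rewrite psiE NegzE mulrNz -(rmorph_int (@RtoC R)) /=; lra.
Qed.

End Residue.

(** * The minimum modulus principle *)

Section MinimumModulus.
Variable R : realType.
Implicit Types (f : CC R -> CC R) (a x z : CC R) (r : R).

Lemma no_local_min_modulus f z : finite_order (fun x => f x - f z) z -> f z != 0 ->
  ~ \forall x \near z, cabs (f z) <= cabs (f x).
Proof.
move=> [j [g [g_cont gz fE]]] fz min_z.
case: j fE => [|j] fE; first by move: gz; rewrite -[g z]mul1r -(expr0 (z - z)) -fE subrr eqxx.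
pose u := j.+1.-root (- (f z / g z)); have uE : u ^+ j.+1 = - (f z / g z) by rewrite rootCK.
have u0 : u != 0 by rewrite rootC_eq0// oppr_eq0 mulf_neq0 ?invr_eq0.
have g_near : \forall x \near z, cabs (g x - g z) < cabs (g z).
  by move/continuous_cabsP: g_cont; apply; rewrite cabs_gt0.
have near_both : \forall x \near z^', cabs (g x - g z) < cabs (g z) /\ cabs (f z) <= cabs (f x).
  by apply: nbhs_dnbhs; exact: filterI.
have [t t01 /(_ t)] := near_ray near_both u0; have /andP[t0 t1] := t01.
rewrite t0 lexx => /(_ isT)[]; set x := z + _ => gx; apply/negP; rewrite -ltNge.
pose s := t ^+ j.+1.
have s0 : 0 < s by rewrite exprn_gt0.
have s1 : s <= 1 by rewrite exprn_ile1// ltW.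
have -> : f x = f z * (RtoC (1 - s) - RtoC s * ((g x - g z) / g z)).
  have xz : x - z = RtoC t * u by rewrite /x addrC addKr.
  rewrite -[LHS](subrK (f z)) fE xz exprMn uE rmorphB rmorph1 /s !rmorphXn /=.
  by field.
rewrite cabsM -[ltRHS]mulr1 ltr_pM2l ?cabs_gt0//.
apply: le_lt_trans (cabsD _ _) _; rewrite cabsN cabsM !cabs_RtoC ger0_norm ?subr_ge0//.
have : cabs ((g x - g z) / g z) < 1 by rewrite cabsM cabsV ltr_pdivrMr ?cabs_gt0// mul1r.
by rewrite gtr0_norm// -(ltr_pM2l s0); lra.
Qed.

Lemma continuous_dist a : continuous (fun x => cabs (x - a)).
Proof.
move=> x; apply: (@continuous_comp _ _ _ (fun x => x - a)); last exact: continuous_cabs.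
by apply: continuousB; [exact: cvg_id|exact: cst_continuous].
Qed.

Lemma compact_disc a r : compact [set x : CC R | cabs (x - a) <= r].
Proof.
apply: (@closed_cabs_bounded_compact _ _ (r + cabs a)) => [|x /= xr].
  exact: ((continuous_closedP _).1 (@continuous_dist a) [set s | s <= r] (@closed_le _ r)).
by rewrite -[x](subrK a) (le_trans (cabsD _ _))// lerD2r.
Qed.

Lemma compact_circle a r : compact [set x : CC R | cabs (x - a) = r].
Proof.
apply: subclosed_compact (@compact_disc a r) _ => [|x /= ->//].
exact: ((continuous_closedP _).1 (@continuous_dist a) [set s | s = r] (@closed_eq _ r)).
Qed.

Lemma minimum_modulus f a r : 0 < r -> continuous f ->
  (forall z, finite_order (fun x => f x - f z) z) ->
  (forall z, cabs (z - a) = r -> cabs (f a) < cabs (f z)) ->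
  exists2 z, cabs (z - a) < r & f z = 0.
Proof.
move=> r0 f_cont f_order boundary.
have disc_a : [set x : CC R | cabs (x - a) <= r] a by rewrite /= subrr cabs0 ltW.
have absf_cont : {within [set x : CC R | cabs (x - a) <= r], continuous (fun x => cabs (f x))}.
  by apply: continuous_subspaceT => x; exact: continuous_cabs_comp (f_cont x).
have [z /[!inE]/= zr z_min] := compact_EVT_min (ex_intro _ _ disc_a) (@compact_disc a r) absf_cont.
have zr_lt : cabs (z - a) < r.
  rewrite lt_neqAle zr andbT; apply/eqP => /boundary.
  by rewrite ltNge z_min// inE.
exists z => //; apply/eqP; apply: contraT => /(no_local_min_modulus (f_order z)); case.
apply/near_cabsP; exists (r - cabs (z - a)); first by rewrite subr_gt0.
move=> x xz; apply: z_min; rewrite inE /= ltW// -[x](subrK z) -addrA.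
by apply: le_lt_trans (cabsD _ _) _; rewrite -ltrBrDr.
Qed.

End MinimumModulus.

(** * The Newton equation *)

Section WexpPolynomial.
Variable R : realType.
Implicit Types (A p q : {poly CC R}) (c v z : CC R).

(* [d/dz A(w) = (wderiv A)(w)] for [w = e^(2 pi i z)]. *)
Definition wderiv A := two_pi_i R *: ('X * A^`()).

Lemma horner_wderiv A z : (wderiv A).[z] = two_pi_i R * z * A^`().[z].
Proof. by rewrite hornerZ hornerM hornerX mulrA. Qed.

Lemma is_derive_horner_wexp A z :
  is_derive z 1 (fun x => A.[wexp x]) (wderiv A).[wexp z].
Proof.
have := is_derive_comp (is_derive_wexp z) (is_derive_horner A (wexp z)).
by rewrite horner_wderiv mulrC.
Qed.

Lemma continuous_horner_wexp A : continuous (fun z => A.[wexp z]).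
Proof. by move=> z; exact: is_derive_continuous (is_derive_horner_wexp A z). Qed.

Lemma horner_wexp_finite_order A z : A != 0 -> finite_order (fun x => A.[wexp x]) z.
Proof.
move=> A0; rewrite (_ : (fun x => _) = exp_poly (map_poly polyC A)).
  by apply: exp_poly_finite_order; rewrite map_poly_eq0.
by apply/funext => x; rewrite exp_poly_map.
Qed.

(* With [c = 1 - l], this is the denominator of [F' / F = q(w) / (c z q(w) - p(w))] when
   [N_F(z) = l z + p(w) / q(w)]. *)
Definition newton_den c p q z := c * z * q.[wexp z] - p.[wexp z].

Lemma newton_den_finite_order c p q z : (c != 0 /\ q != 0) \/ p != 0 ->
  finite_order (newton_den c p q) z.
Proof.
pose P := (c *: 'X)%:P * map_poly polyC q - map_poly polyC p => pq0.
rewrite (_ : newton_den c p q = exp_poly P); last first.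
  apply/funext => x; rewrite /exp_poly hornerD hornerN hornerM !hornerC !horner_map /=.
  by rewrite hornerD hornerN hornerM !hornerC hornerZ hornerX.
apply: exp_poly_finite_order; apply/eqP => P0.
have coefP i : (c * q`_i) *: 'X - (p`_i)%:P = 0 :> {poly CC R}.
  rewrite -[RHS](coef0 _ i) -P0 coefB coefCM !coef_map /= [_ * _%:P]mulrC mul_polyC scalerA.
  by rewrite [q`_i * c]mulrC.
have q_coef i : c * q`_i = 0.
  by have := congr1 (fun Q : {poly CC R} => Q`_1) (coefP i);
    rewrite coefB coefZ coefX coefC mulr1 subr0 coef0.
have p_coef i : p`_i = 0.
  by have := congr1 (fun Q : {poly CC R} => Q`_0) (coefP i);
    rewrite coefB coefZ coefX coefC mulr0 sub0r coef0 => /eqP; rewrite oppr_eq0 => /eqP.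
case: pq0 => [[c0 /eqP[]]|/eqP[]]; apply/polyP => i; rewrite coef0 ?p_coef//.
by apply: (mulfI c0); rewrite q_coef mulr0.
Qed.

Lemma newton_den_sub_finite_order c p q v z : c != 0 -> q != 0 ->
  finite_order (fun x => newton_den c p q x - v) z.
Proof.
move=> c0 q0; rewrite (_ : (fun x => _) = newton_den c (p + v%:P) q).
  by apply: newton_den_finite_order; left.
by apply/funext => x; rewrite /newton_den hornerD hornerC opprD addrA.
Qed.

Lemma is_derive_newton_den c p q z : is_derive z 1 (newton_den c p q)
  (c * q.[wexp z] + c * z * (wderiv q).[wexp z] - (wderiv p).[wexp z]).
Proof.
have := is_deriveB (is_deriveM (is_deriveZ c (is_derive_id z (1 : CC R)))
  (is_derive_horner_wexp q z)) (is_derive_horner_wexp p z).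
by congr (is_derive _ _ _ _); rewrite /GRing.scale /= /GRing.scale /=; ring.
Qed.

Lemma continuous_newton_den c p q : continuous (newton_den c p q).
Proof. by move=> z; exact: is_derive_continuous (is_derive_newton_den c p q z). Qed.

Lemma newton_den_common_root c p q z : coprimep p q -> newton_den c p q z = 0 ->
  q.[wexp z] != 0.
Proof.
move=> cop denz; apply/eqP => qz; have /coprimep_root pz : coprimep q p by rewrite coprimep_sym.
have /negP[] := pz _ (introT eqP qz).
by move/eqP: denz; rewrite /newton_den qz mulr0 sub0r oppr_eq0.
Qed.

End WexpPolynomial.

Section NewtonODE.
Variables (R : realType) (F : CC R -> CC R) (l : int) (p q : {poly CC R}).
Hypothesis F_entire : entire F.
Hypothesis F_root : exists z, F z = 0.
Hypothesis F_neq0 : exists z, F z != 0.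
Hypothesis p_neq0 : p != 0.
Hypothesis q_neq0 : q != 0.
Hypothesis pq_coprime : coprimep p q.
Hypothesis newtonE : forall z, cderiv F z != 0 -> q.[wexp z] != 0 ->
  newton F z = l%:~R * z + p.[wexp z] / q.[wexp z].

Let c : CC R := 1 - l%:~R.
Let den := newton_den c p q.

Definition newton_domain : set (CC R) :=
  [set z | q.[wexp z] != 0 /\ newton_den (1 - l%:~R) p q z != 0].

Lemma is_derive_entire (z : CC R) : is_derive z 1 F (cderiv F z).
Proof. exact/derivableP/F_entire. Qed.

Lemma newton_domain_codiscrete : codiscrete newton_domain.
Proof.
move=> z; have qz := finite_order_near_neq0 (horner_wexp_finite_order z q_neq0).
have denz : \forall x \near z^', den x != 0.
  by apply: finite_order_near_neq0; apply: newton_den_finite_order; right.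
by apply: filterS2 qz denz => x; split.
Qed.

Let continuous_log_derivative z : newton_domain z ->
  {for z, continuous (fun x => q.[wexp x] / den x)}.
Proof.
move=> [_ denz]; apply: (@continuousM (CC R) (CC R)); first exact: continuous_horner_wexp.
by apply: (@continuousV (CC R) (CC R)) denz _; exact: continuous_newton_den.
Qed.

Lemma newton_log_derivative z : newton_domain z ->
  cderiv F z = F z * (q.[wexp z] / newton_den (1 - l%:~R) p q z).
Proof.
apply: (log_derivative_dichotomy newton_domain_codiscrete is_derive_entire
  continuous_log_derivative _ _ F_root) => {}z [qz denz].
  by rewrite mulf_neq0// invr_eq0.
have [->|dF0] := eqVneq (cderiv F z) 0; [by left|right].
have := newtonE dF0 qz; rewrite /newton => newton_z.
have quotient : F z / cderiv F z = den z / q.[wexp z].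
  have -> : F z / cderiv F z = z - (z - F z / cderiv F z) by ring.
  by rewrite newton_z /den /newton_den /c; field.
have F0 : F z != 0.
  by apply: contra_neq denz => Fz; move/eqP: quotient; rewrite Fz mul0r eq_sym mulf_eq0
    invr_eq0 (negbTE qz) orbF => /eqP.
by rewrite -[q.[_] / _]invf_div -quotient invf_div mulrC divfK.
Qed.

Lemma newton_domain_neq0 z : newton_domain z -> F z != 0.
Proof.
exact: (linear_ode_neq0 newton_domain_codiscrete is_derive_entire continuous_log_derivative
  newton_log_derivative F_neq0).
Qed.

Lemma newton_den_root_residue z : newton_den (1 - l%:~R) p q z = 0 ->
  exists n : nat, q.[wexp z] = n.+1%:R *
    (c * q.[wexp z] + c * z * (wderiv q).[wexp z] - (wderiv p).[wexp z]).
Proof.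
move=> denz; have qz := newton_den_common_root pq_coprime denz.
have F_near : \forall x \near z^', F x != 0.
  by apply: filterS (newton_domain_codiscrete z) => x; exact: newton_domain_neq0.
have ode : \forall x \near z^', cderiv F x * den x = F x * q.[wexp x].
  apply: filterS (newton_domain_codiscrete z) => x Vx; rewrite (newton_log_derivative Vx).
  by rewrite mulrA divfK//; case: Vx.
have den_order : finite_order den z by apply: newton_den_finite_order; right.
exact: (log_derivative_residue is_derive_entire F_near ode (@continuous_horner_wexp R q z) qz
  den_order denz (is_derive_newton_den c p q z)).
Qed.

End NewtonODE.

(** * The coefficient of [z] *)

Lemma wronskian_multiplicity (K : comNzRingType) (p v : {poly K}) (w : K) m :
  let q := v * ('X - w%:P) ^+ m.+1 in
  exists2 g : {poly K}, p * q^`() - p^`() * q = ('X - w%:P) ^+ m * g &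
    g.[w] = m.+1%:R * (p.[w] * v.[w]).
Proof.
exists (p * (v^`() * ('X - w%:P) + m.+1%:R * v) - p^`() * (v * ('X - w%:P))).
  by rewrite derivM deriv_exp derivXsubC mul1r -mulr_natl exprS; ring.
by rewrite !(hornerXsubC, hornerD, hornerN, hornerM) subrr -polyC_natr hornerC; ring.
Qed.

Section WronskianAtPole.
Variable R : realType.
Implicit Types (p q s : {poly CC R}) (w : CC R).

(* Dividing by [q ^ 2]: at a pole of [p / q], the derivative of [p / q] tends to infinity. *)
Lemma sqr_lt_wronskian_near p q s w (A : R) : q != 0 -> root q w -> p.[w] != 0 -> s.[w] != 0 ->
  \forall x \near w^', A * cabs q.[x] ^+ 2 < cabs (s * (p * q^`() - p^`() * q)).[x].
Proof.
move=> q0 qw pw sw; have [m [v vw qE]] := multiplicity_XsubC q w; rewrite q0 /= in vw.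
case: m qE => [|m] qE; first by move: qw vw; rewrite qE expr0 mulr1 => ->.
have [g wronskianE gw] := wronskian_multiplicity p v w m; rewrite -qE in wronskianE.
pose sg := s * g; pose rest := v ^+ 2 * ('X - w%:P) ^+ m.+2.
have sgw : sg.[w] != 0 by rewrite hornerM gw !mulf_neq0 ?pnatr_eq0.
have rest0 : rest.[w] = 0 by rewrite hornerM !horner_exp hornerXsubC subrr expr0n mulr0.
have horner_cont (u : {poly CC R}) : continuous (fun x => cabs u.[x]).
  by move=> x; exact: continuous_cabs_comp (is_derive_continuous (is_derive_horner u x)).
have diff_cont : {for w, continuous (fun x => cabs sg.[x] - A * cabs rest.[x])}.
  apply: continuousB; first exact: horner_cont.
  by apply: continuousM; [exact: cst_continuous|exact: horner_cont].
have near_pos : \forall x \near w^', 0 < cabs sg.[x] - A * cabs rest.[x].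
  by apply: nbhs_dnbhs; apply: (cvgr_gt _ diff_cont); rewrite rest0 cabs0 mulr0 subr0 cabs_gt0.
apply: filterS2 (nbhs_dnbhs_neq w) near_pos => x xw; rewrite subr_gt0 => rest_lt.
have xw0 : 0 < cabs (x - w) ^+ m by rewrite exprn_gt0// cabs_gt0 subr_eq0.
have -> : (s * (p * q^`() - p^`() * q)).[x] = (x - w) ^+ m * sg.[x].
  by rewrite wronskianE mulrCA hornerM horner_exp hornerXsubC.
have -> : A * cabs q.[x] ^+ 2 = cabs (x - w) ^+ m * (A * cabs rest.[x]).
  rewrite qE /rest !hornerM !horner_exp hornerXsubC !cabsM !cabsX !exprS; ring.
by rewrite cabsM cabsX ltr_pM2l.
Qed.

End WronskianAtPole.

Section NewtonDenZeros.
Variable R : realType.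
Implicit Types (p q : {poly CC R}) (a c x z : CC R) (r e : R).

Lemma newton_den_large_on_circle c p q a r : c != 0 -> 0 < r ->
  (forall x, cabs (x - a) = r -> q.[wexp x] != 0) ->
  exists n : nat, forall y, cabs (y - a) = r ->
    cabs p.[wexp a] < cabs (newton_den c p q (y + n%:R)).
Proof.
move=> c0 r0 q_circle; pose circle := [set x : CC R | cabs (x - a) = r].
have circle_neq0 : circle !=set0.
  by exists (a + RtoC r); rewrite /circle /= addrC addKr cabs_RtoC gtr0_norm.
have abs_cont A : {within circle, continuous (fun x => cabs A.[wexp x])}.
  apply: continuous_subspaceT => x.
  exact: (continuous_cabs_comp (f := fun x => A.[wexp x]) (@continuous_horner_wexp R A x)).
have [y1 /[!inE] circle_y1 q_min] :=
  compact_EVT_min circle_neq0 (@compact_circle R a r) (@abs_cont q).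
have [y2 /[!inE] circle_y2 p_max] :=
  compact_EVT_max circle_neq0 (@compact_circle R a r) (@abs_cont p).
have qy1 : 0 < cabs c * cabs q.[wexp y1] by rewrite mulr_gt0 ?cabs_gt0 ?q_circle.
pose bound := (cabs p.[wexp y2] + cabs p.[wexp a]) / (cabs c * cabs q.[wexp y1]).
have [n n_large] : exists n : nat, bound + cabs a + r < n%:R.
  by exists (Num.truncn (bound + cabs a + r)).+1; exact: truncnS_gt.
exists n => y circle_y; rewrite /newton_den !wexpDn.
have p_le : cabs p.[wexp y] <= cabs p.[wexp y2] by rewrite p_max// inE.
have q_ge : cabs q.[wexp y1] <= cabs q.[wexp y] by rewrite q_min// inE.
have y_ge : bound < cabs (y + n%:R).
  have := cabsB_ge n%:R (- y); rewrite opprK cabsN cabs_nat [_ + y]addrC.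
  by have := cabsB_ge y a; rewrite circle_y; lra.
have : bound * (cabs c * cabs q.[wexp y1]) < cabs (y + n%:R) * (cabs c * cabs q.[wexp y]).
  apply: (@lt_le_trans _ _ (cabs (y + n%:R) * (cabs c * cabs q.[wexp y1]))).
    by rewrite ltr_pM2r.
  by rewrite ler_wpM2l ?cabs_ge0// ler_wpM2l ?cabs_ge0.
rewrite /bound divfK ?gt_eqF//.
have := cabsB_ge (c * (y + n%:R) * q.[wexp y]) p.[wexp y]; rewrite !cabsM mulrAC.
lra.
Qed.

(* On a small circle around [a + n] the function [|c z q - p|] grows with [n], while at the
   centre, where [q] vanishes, it does not depend on [n]. *)
Lemma newton_den_zero_near_pole c p q a e : c != 0 -> q != 0 -> q.[wexp a] = 0 -> 0 < e ->
  exists2 z, newton_den c p q z = 0 & cabs (wexp z - wexp a) < e.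
Proof.
move=> c0 q0 qa e0.
have wexp_cont : {for a, continuous (@wexp R)} := is_derive_continuous (is_derive_wexp a).
have wexp_near : \forall x \near a^', cabs (wexp x - wexp a) < e.
  by move/continuous_cabsP/(_ e e0): wexp_cont; exact: nbhs_dnbhs.
have /near_punctured_cabsP[r r0 near_a] : \forall x \near a^',
    q.[wexp x] != 0 /\ cabs (wexp x - wexp a) < e.
  by apply: filterI wexp_near; exact: finite_order_near_neq0 (horner_wexp_finite_order a q0).
have r20 : 0 < r / 2 by rewrite divr_gt0.
have r2_lt : r / 2 < r by rewrite ltr_pdivrMr// ltr_pMr// ltr1n.
have [x xa|n n_large] := @newton_den_large_on_circle c p q a _ c0 r20.
  have x_a : x != a by rewrite -subr_eq0 -cabs_eq0 xa gt_eqF.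
  by have [] := near_a x x_a; rewrite ?xa.
have shiftB z : z - (a + n%:R) = z - n%:R - a by ring.
have [||z|z z_near denz] := @minimum_modulus R (newton_den c p q) (a + n%:R) _ r20.
- exact: continuous_newton_den.
- by move=> z; exact: newton_den_sub_finite_order.
- rewrite shiftB => /n_large; rewrite subrK.
  by rewrite /newton_den !wexpDn qa mulr0 sub0r cabsN.
exists z => //; rewrite shiftB in z_near; rewrite -(subrK n%:R z) wexpDn.
have [->|yz] := eqVneq (z - n%:R) a; first by rewrite subrr cabs0.
by have [] := near_a _ yz (lt_trans z_near r2_lt).
Qed.

End NewtonDenZeros.

Lemma newton_map_linear_coef (R : realType) (F : CC R -> CC R) (l : int) (p q : {poly CC R}) :
  entire F -> (exists z, F z = 0) -> (exists z, F z != 0) ->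
  p != 0 -> q.[0] != 0 -> coprimep p q -> (exists w, root q w) ->
  (forall z, cderiv F z != 0 -> q.[wexp z] != 0 ->
    newton F z = l%:~R * z + p.[wexp z] / q.[wexp z]) -> l = 1.
Proof.
move=> F_entire F_root F_neq0 p0 q00 cop [w qw] newtonE; apply/eqP; apply: contraT => l1.
have q0 : q != 0 by apply: contraNneq q00 => ->; rewrite horner0.
pose c : CC R := 1 - l%:~R; have c0 : c != 0 by rewrite subr_eq0 eq_sym -[1]/(1%:~R) eqr_int.
have w0 : w != 0 by apply: contraNneq q00 => w0; move: qw; rewrite w0.
have [a aE] := wexp_surj w0.
have pw : p.[w] != 0 by apply: coprimep_root qw; rewrite coprimep_sym.
have sw : (two_pi_i R *: 'X).[w] != 0 by rewrite hornerZ hornerX mulf_neq0 ?two_pi_i_neq0.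
have /near_punctured_cabsP[e e0 near_w] := sqr_lt_wronskian_near (1 + cabs c) q0 qw pw sw.
have qa : q.[wexp a] = 0 by rewrite aE; exact/rootP.
have [z denz zw] := newton_den_zero_near_pole p c0 q0 qa e0.
have qz := newton_den_common_root cop denz; rewrite aE in zw.
have [n nE] := newton_den_root_residue F_entire F_root F_neq0 p0 q0 cop newtonE denz.
have zw_neq : wexp z != w by apply: contraNneq qz => ->.
have := near_w _ zw_neq zw.
have n0 : n.+1%:R != 0 :> CC R by rewrite pnatr_eq0.
have -> : (two_pi_i R *: 'X * (p * q^`() - p^`() * q)).[wexp z] =
    q.[wexp z] ^+ 2 * (n.+1%:R^-1 - c).
  have pE : p.[wexp z] = c * z * q.[wexp z] by apply/esym/eqP; rewrite -subr_eq0; exact/eqP.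
  move: nE; rewrite -/c !horner_wderiv => /(congr1 (fun u => n.+1%:R^-1 * u)).
  rewrite mulKf// => nE.
  transitivity (q.[wexp z] * (n.+1%:R^-1 * q.[wexp z] - c * q.[wexp z])); last by ring.
  by rewrite nE hornerM hornerZ hornerX !(hornerD, hornerN, hornerM) pE; ring.
rewrite cabsM cabsX mulrC ltr_pM2l ?exprn_gt0 ?cabs_gt0//.
apply/contraTT; rewrite -leNgt => _; apply: le_trans (cabsD _ _) _.
by rewrite cabsN lerD2r cabsV cabs_nat invf_le1 ?ltr0n// ler1n.
Qed.

(** * Partial fractions of logarithmic derivatives *)

Section PolynomialCoefficients.
Variable K : comNzRingType.
Implicit Types A B : {poly K}.

Lemma coefM_top A B m n : (size A <= m.+1)%N -> (size B <= n.+1)%N ->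
  (A * B)`_(m + n) = A`_m * B`_n.
Proof.
move=> Am Bn; have m_lt : (m < (m + n).+1)%N by rewrite ltnS leq_addr.
rewrite coefM (bigD1 (Ordinal m_lt)) //= addKn big1 ?addr0// => -[i i_lt] /=.
rewrite -val_eqE /= neq_ltn => /orP[im|mi]; last by rewrite nth_default ?mul0r// (leq_trans Am).
by rewrite [B`__]nth_default ?mulr0// (leq_trans Bn)// ltn_subRL ltn_add2r.
Qed.

Lemma lt_size_coef A n : (size A <= n.+1)%N -> (n < size A)%N = (A`_n != 0).
Proof.
move=> An; apply/idP/idP => [nA|]; last by apply: contraNT; rewrite -leqNgt => /(nth_default 0)->.
have sA : size A = n.+1 by apply/eqP; rewrite eqn_leq An.
have -> : A`_n = lead_coef A by rewrite lead_coefE sA.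
by rewrite lead_coef_eq0 -size_poly_gt0 sA.
Qed.

Definition rev_poly n A : {poly K} := \poly_(i < n.+1) A`_(n - i).

Lemma coef_rev_poly n A i : (rev_poly n A)`_i = if (i <= n)%N then A`_(n - i) else 0.
Proof. by rewrite coef_poly ltnS. Qed.

End PolynomialCoefficients.

Lemma leq_size_cross (K : idomainType) (A B C D : {poly K}) : A != 0 -> D != 0 ->
  A * D = B * C -> (size A <= size B)%N -> (size C <= size D)%N.
Proof.
move=> A0 D0 AD_BC AB; have AD0 : A * D != 0 by rewrite mulf_neq0.
have /andP[B0 C0] : (B != 0) && (C != 0) by rewrite -negb_or -mulf_eq0 -AD_BC.
have : (size A + size D = size B + size C)%N.
  have := congr1 (size : {poly K} -> nat) AD_BC; rewrite !size_mul//.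
  by move/(congr1 S); rewrite !prednK ?addn_gt0 ?size_poly_gt0 ?A0 ?B0.
by move=> sizeE; rewrite -(leq_add2l (size A)) sizeE leq_add2r.
Qed.

Lemma horner_rev_poly (K : fieldType) (A : {poly K}) (x : K) n : x != 0 ->
  (size A <= n.+1)%N -> (rev_poly n A).[x] = x ^+ n * A.[x^-1].
Proof.
move=> x0 An; rewrite (horner_coef_wide _ An) horner_poly (reindex_inj rev_ord_inj) mulr_sumr.
apply: eq_bigr => i _ /=; have i_le : (i <= n)%N by rewrite -ltnS.
by rewrite subSS subKn// mulrCA expfB_cond ?(negbTE x0)// exprVn.
Qed.

(* The poles of [q / (A p)] are simple with integral residues, hence [q / p - A P' / P] is a
   polynomial [T] for a suitable product [P] of powers of the [X - x]. *)
Lemma log_partial_fractions (K : closedFieldType) (p q A : {poly K}) : p != 0 ->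
  (forall x, root p x -> p^`().[x] != 0) ->
  (forall x, root p x -> exists n, q.[x] = n%:R * (A.[x] * p^`().[x])) ->
  exists P T, [/\ P != 0, forall x, root P x -> root p x &
    q * P = p * (A * P^`() + T * P)].
Proof.
have [n] := ubnP (size p); elim: n p q => // n IH p q pn p0 p_sep q_res.
have [/closed_rootP[x px]|] := boolP (size p != 1); last first.
  rewrite negbK => /size_poly1P[k k0 pE]; exists 1, (k^-1 *: q); split; first exact: oner_neq0.
    by move=> x; rewrite (negbTE (root1 x)).
  by rewrite pE derivC mulr0 add0r !mulr1 mul_polyC scalerA divff// scale1r.
have /factor_theorem[p2 pE] := px; pose b := 'X - x%:P; rewrite -/b in pE.
have p'E y : p^`().[y] = p2^`().[y] * (y - x) + p2.[y].
  by rewrite pE derivM derivXsubC mulr1 hornerD hornerM hornerXsubC.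
have p2x : p2.[x] != 0 by have := p_sep x px; rewrite p'E subrr mulr0 add0r.
have [m q_x] := q_res x px; rewrite p'E subrr mulr0 add0r in q_x.
have /factor_theorem[q2 q2E] : root (q - m%:R * (A * p2)) x.
  by rewrite /root hornerD hornerN !hornerM -polyC_natr hornerC q_x subrr.
have p2_root y : root p2 y -> [/\ root p y, y - x != 0 & p^`().[y] = p2^`().[y] * (y - x)].
  move=> p2y; split; first by rewrite pE rootM p2y.
    by rewrite subr_eq0; apply: contraTneq p2y => ->; rewrite rootE.
  by rewrite p'E (rootP p2y) addr0.
have p20 : p2 != 0 by apply: contraNneq p2x => ->; rewrite horner0.
have [|y|y|P2 [T [P20 P2_root P2E]]] := IH p2 q2 _ p20.
- by move: pn; rewrite pE size_Mmonic ?monicXsubC// size_XsubC addn2.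
- by move=> /p2_root[/p_sep + _ p'y]; rewrite p'y mulf_eq0 negb_or => /andP[].
- move=> p2y; have [/q_res[k q_y] yx p'y] := p2_root y p2y; exists k; apply: (mulIf yx).
  have := congr1 (horner^~ y) q2E; rewrite /= hornerD hornerN !hornerM (rootP p2y) !mulr0 subr0.
  by rewrite hornerXsubC => <-; rewrite q_y p'y; ring.
exists (P2 * b ^+ m), T; split.
- by rewrite mulf_neq0// expf_neq0// polyXsubC_eq0.
- move=> y; rewrite rootM => /orP[/P2_root p2y|]; first by rewrite pE rootM p2y.
  by rewrite /root horner_exp hornerXsubC expf_eq0 subr_eq0 => /andP[_ /eqP->].
have -> : q = q2 * b + m%:R * (A * p2) by rewrite -q2E subrK.
rewrite derivM deriv_exp derivXsubC mul1r -mulr_natl.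
set u := m%:R * b ^+ m.-1; have ub : u * b = m%:R * b ^+ m.
  by rewrite /u; case: m {q_x q2E u} => [|m]; rewrite ?mul0r// -mulrA -exprSr.
transitivity (b * b ^+ m * (q2 * P2) + A * p2 * P2 * (u * b)); first by rewrite ub; ring.
by rewrite P2E pE /u; ring.
Qed.

Section LogarithmicDerivative.
Variable R : realType.
Implicit Types (A P Q Qt T : {poly CC R}) (c w z : CC R) (e i : nat).

Lemma coef_wderiv A i : (wderiv A)`_i = two_pi_i R * i%:R * A`_i.
Proof.
rewrite coefZ coefXM; case: i => [|i]; first by rewrite /= !(mulr0, mul0r).
by rewrite coef_deriv -mulrA mulr_natl.
Qed.

Lemma size_wderiv A : (size (wderiv A) <= size A)%N.
Proof. by apply/leq_sizeP => i Ai; rewrite coef_wderiv nth_default ?mulr0. Qed.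

(* [wderiv P / P + T / X^e = log_num e P T / (X^e P)]. *)
Definition log_num e P T := 'X^e * wderiv P + T * P.

Lemma size_log_num e P T : P != 0 ->
  (size ('X^e * P)%R <= size (log_num e P T))%N =
  ((size T <= e.+1)%N ==> (T`_e + two_pi_i R * (size P).-1%:R != 0)).
Proof.
move=> P0; have sP : size P = (size P).-1.+1 by rewrite prednK// size_poly_gt0.
set d := (size P).-1 in sP *; have -> : size ('X^e * P) = (e + d).+1.
  by rewrite mulrC size_Mmonic ?monicXn// size_polyXn addnS sP addSn addnC.
have sXP : (size ('X^e * wderiv P)%R <= (e + d).+1)%N.
  apply: leq_trans (size_polyMleq _ _) _; rewrite size_polyXn /= -addnS leq_add2l -sP.
  exact: size_wderiv.
have [Te|eT] /= := leqP (size T) e.+1; last first.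
  have sTP : ((e + d).+1 < size (T * P)%R)%N.
    have T0 : T != 0 by rewrite -size_poly_gt0 (leq_trans _ eT).
    by rewrite size_mul// sP addnS /= -addSn ltn_add2r.
  have sXP_lt : (size ('X^e * wderiv P)%R < size (T * P)%R)%N := leq_ltn_trans sXP sTP.
  by rewrite [log_num _ _ _]addrC (size_polyDl sXP_lt) ltnW.
rewrite lt_size_coef; last first.
  apply: leq_trans (size_polyD _ _) _; rewrite geq_max sXP.
  by apply: leq_trans (size_polyMleq _ _) _; rewrite sP addnS /= -addSn leq_add2r.
rewrite coefD coefXnM ltnNge leq_addr /= addKn coef_wderiv (coefM_top Te) ?sP//.
rewrite -mulrDl mulf_eq0 negb_or addrC [X in _ && X](_ : _ = true) ?andbT//.
by rewrite -lead_coefE lead_coef_eq0.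
Qed.

(* [laurent_num e c Q Qt / X^e] is the derivative of [c z + Q(w) + Qt(1 / w)]. *)
Definition laurent_num e c Q Qt := 'X^e * (c%:P + wderiv Q) - rev_poly e (wderiv Qt).

Lemma horner_laurent_num e c Q Qt w : w != 0 -> (size Qt <= e.+1)%N ->
  (laurent_num e c Q Qt).[w] = w ^+ e * (c + (wderiv Q).[w] - (wderiv Qt).[w^-1]).
Proof.
move=> w0 Qte; rewrite hornerD hornerN horner_rev_poly ?(leq_trans (size_wderiv _))//.
by rewrite hornerM hornerXn hornerD hornerC mulrBr.
Qed.

Lemma coef_laurent_num e c Q Qt i : (laurent_num e c Q Qt)`_i =
  if (i < e)%N then - (wderiv Qt)`_(e - i) else (c%:P + wderiv Q)`_(i - e).
Proof.
rewrite coefB coefXnM coef_rev_poly; case: ltngtP => [ie|ei|->]; first by rewrite sub0r.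
  by rewrite subr0.
by rewrite subnn [X in _ - X]coef_wderiv mulr0 mul0r subr0.
Qed.

Lemma laurent_num_residue e c Q Qt : (laurent_num e c Q Qt)`_e = c.
Proof. by rewrite coef_laurent_num ltnn subnn coefD coefC coef_wderiv mulr0 mul0r addr0. Qed.

Lemma size_laurent_num e c Q Qt :
  (size (laurent_num e c Q Qt) <= e.+1)%N = (size Q <= 1)%N.
Proof.
apply/leq_sizeP/leq_sizeP => [T0 [//|k] _|Q0 i ei].
  have ek : (e < e + k.+1)%N by rewrite addnS ltnS leq_addr.
  have := T0 _ ek; rewrite coef_laurent_num ltnNge ltnW//= addKn coefD coefC add0r coef_wderiv.
  by move=> /eqP; rewrite !mulf_eq0 (negbTE (two_pi_i_neq0 R)) pnatr_eq0 => /eqP.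
rewrite coef_laurent_num ltnNge ltnW//= coefD coefC coef_wderiv subn_eq0 leqNgt ei add0r.
by rewrite Q0 ?mulr0// subn_gt0.
Qed.

Lemma laurent_num_eq0 e c Q Qt : (laurent_num e c Q Qt).[0] =
  if e == 0%N then c else - (two_pi_i R * e%:R * Qt`_e).
Proof.
rewrite horner_coef0 coef_laurent_num lt0n subn0 sub0n; case: eqVneq => [->|_] /=.
  by rewrite coefD coefC coef_wderiv mulr0 mul0r addr0.
by rewrite coef_wderiv.
Qed.

(* The constant coefficient is [0] since [x / 0 = 0]. *)
Definition wprimitive A := \poly_(i < size A) (A`_i / (two_pi_i R * i%:R)).

Lemma coef_wderiv_primitive A i : (0 < i)%N -> (wderiv (wprimitive A))`_i = A`_i.
Proof.
move=> i0; rewrite coef_wderiv coef_poly; case: ltnP => [_|/(nth_default 0)->]; last first.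
  by rewrite mulr0.
by rewrite mulrC divfK// mulf_neq0 ?two_pi_i_neq0// pnatr_eq0 -lt0n.
Qed.

Lemma laurent_num_surj e T :
  exists Q Qt, (size Qt <= e.+1)%N /\ T = laurent_num e T`_e Q Qt.
Proof.
exists (wprimitive (drop_poly e T)), (wprimitive (- rev_poly e T)).
split; first by apply: leq_trans (size_poly _ _) _; rewrite size_polyN size_poly.
apply/polyP => i; rewrite coef_laurent_num; case: ltnP => [ie|ei].
  by rewrite coef_wderiv_primitive ?subn_gt0// coefN coef_rev_poly leq_subr subKn ?opprK// ltnW.
rewrite coefD coefC; case: posnP => [ie|ie]; last first.
  by rewrite add0r coef_wderiv_primitive// coef_drop_poly subnK.
by rewrite ie coef_wderiv mulr0 mul0r addr0; congr T`__; apply/eqP; rewrite eqn_leq ei -subn_eq0 ie.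
Qed.

End LogarithmicDerivative.

(** * Exponential forms and Newton maps *)

Lemma dvdp_deriv_size_le1 (K : numFieldType) (P : {poly K}) : P %| P^`() -> (size P <= 1)%N.
Proof.
move=> P_dvd; apply: deriv_eq0_size_le1; apply/eqP; apply: contraLR P_dvd => P'0.
have P0 : P != 0 by apply: contraNneq P'0 => ->; rewrite deriv0.
by apply/negP => /(dvdp_leq P'0); rewrite leqNgt lt_size_deriv.
Qed.

Section RationalLogDerivative.
Variable R : realType.
Implicit Types (p q P T : {poly CC R}) (e : nat).

Lemma admissible_rat_root p q : p != 0 -> (exists w, root p w) -> coprimep p q ->
  q.[0] != 0 -> (size p <= size q)%N -> admissible_rat p q.
Proof.
move=> p0 [w1 pw1] cop q00 size_pq.
have q0 : q != 0 by apply: contraNneq q00 => ->; rewrite horner0.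
split=> //; last first.
  apply/closed_rootP; rewrite neq_ltn (leq_trans _ size_pq) ?orbT//.
  exact: root_size_gt1 p0 pw1.
have /closed_nonrootP[w2] : p * q != 0 by rewrite mulf_neq0.
rewrite rootM negb_or => /andP[pw2 qw2]; exists w1, w2; split=> //.
  exact: coprimep_root cop pw1.
by rewrite (rootP pw1) mul0r eq_sym mulf_neq0// invr_eq0.
Qed.

(* After cancelling [gcd(P, P')], the zeros of [P] become simple poles. *)
Lemma log_num_admissible e P T : P.[0] != 0 -> (exists w, root P w) -> T.[0] != 0 ->
  (size ('X^e * P)%R <= size (log_num e P T))%N ->
  exists S q g, [/\ P = S * g, log_num e P T = q * g & admissible_rat (- ('X^e * S)) q].
Proof.
move=> P00 [w0 Pw0] T00 size_le.
have P0 : P != 0 by apply: contraNneq P00 => ->; rewrite horner0.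
pose g := gcdp P P^`(); pose S := P %/ g; pose L := P^`() %/ g.
have PE : P = S * g by rewrite divpK ?dvdp_gcdl.
have P'E : P^`() = L * g by rewrite divpK ?dvdp_gcdr.
have SL : coprimep S L by rewrite coprimep_div_gcd// P0.
pose q := two_pi_i R *: ('X^e * ('X * L)) + T * S; exists S, q, g.
have numE : log_num e P T = q * g.
  by rewrite /log_num /wderiv P'E [in T * P]PE /q mulrDl -scalerAl -scalerAr !mulrA.
have /andP[S0 g0] : (S != 0) && (g != 0) by rewrite -negb_or -mulf_eq0 -PE.
have S00 : S.[0] != 0 by move: P00; rewrite PE hornerM mulf_eq0 negb_or => /andP[].
have q00 : q.[0] != 0.
  by rewrite hornerD hornerZ !hornerM hornerX mul0r !mulr0 add0r mulf_neq0.
have q_root w : root S w -> q.[w] != 0.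
  move=> Sw; have w0' : w != 0 by apply: contraTneq Sw => ->.
  rewrite hornerD hornerZ !hornerM hornerXn hornerX (rootP Sw) mulr0 addr0.
  by rewrite !mulf_neq0 ?expf_neq0 ?two_pi_i_neq0//; exact: coprimep_root SL Sw.
split=> //; apply: admissible_rat_root => //.
- by rewrite oppr_eq0 mulf_neq0// expf_neq0// polyX_eq0.
- suff /closed_rootP[w Sw] : size S != 1%N by exists w; rewrite rootN rootM Sw orbT.
  apply: contraTneq (root_size_gt1 P0 Pw0) => /eqP/size_poly1P[k k0 SE]; rewrite -leqNgt.
  by apply: dvdp_deriv_size_le1; rewrite P'E {1}PE SE mul_polyC dvdpZl// dvdp_mull.
- apply: Pdiv.ClosedField.root_coprimep => w; rewrite rootN rootM => /orP[|/q_root//].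
  by rewrite rootE hornerXn expf_eq0 => /andP[_ /eqP->].
- rewrite size_polyN; apply: leq_size_cross size_le.
  + by rewrite mulf_neq0// expf_neq0// polyX_eq0.
  + by apply: contraNneq q00 => ->; rewrite horner0.
  + by rewrite numE PE; ring.
Qed.

End RationalLogDerivative.

Section ExponentialForm.
Variable R : realType.
Implicit Types (A P Q Qt : {poly CC R}) (c z Lam : CC R) (e : nat).

Definition exp_form c P Q Qt z :=
  P.[wexp z] * cexp (c * z + (Q.[wexp z] + Qt.[(wexp z)^-1])).

Lemma exp_formE Lam (m : int) P Q Qt z : let w := wexp z in
  cexp (Lam * z) * (w ^ m * P.[w] * cexp (Q.[w] + Qt.[w^-1])) =
  exp_form (Lam + two_pi_i R * m%:~R) P Q Qt z.
Proof. by rewrite /= wexpXz /exp_form mulrDl !cexpD; ring. Qed.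

Lemma is_derive_horner_wexpV A z :
  is_derive z 1 (fun x => A.[(wexp x)^-1]) (- (wderiv A).[(wexp z)^-1]).
Proof.
have w0 := wexp_neq0 z.
have := is_derive_comp (is_derive_invr w0 (is_derive_wexp z)) (is_derive_horner A (wexp z)^-1).
by congr (is_derive _ _ _ _); rewrite horner_wderiv; field.
Qed.

Lemma is_derive_exp_form e c P Q Qt z : (size Qt <= e.+1)%N ->
  is_derive z 1 (exp_form c P Q Qt)
    ((log_num e P (laurent_num e c Q Qt)).[wexp z] / wexp z ^+ e *
     cexp (c * z + (Q.[wexp z] + Qt.[(wexp z)^-1]))).
Proof.
move=> Qte; have we : wexp z ^+ e != 0 by rewrite expf_neq0// wexp_neq0.
have dE := is_deriveD (is_deriveZ c (is_derive_id z (1 : CC R)))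
  (is_deriveD (is_derive_horner_wexp Q z) (is_derive_horner_wexpV Qt z)).
have := is_deriveM (is_derive_horner_wexp P z) (is_derive_comp dE (is_derive_cexp _)).
congr (is_derive _ _ _ _); rewrite /log_num hornerD !hornerM hornerXn.
rewrite horner_laurent_num ?wexp_neq0// /GRing.scale /= /GRing.scale /=.
by field.
Qed.

Lemma exp_form_regular_infty e c P Q Qt : P != 0 ->
  (size ('X^e * P)%R <= size (log_num e P (laurent_num e c Q Qt)))%N =
  ((size Q <= 1)%N ==> (c + two_pi_i R * (size P).-1%:R != 0)).
Proof. by move=> P0; rewrite size_log_num// size_laurent_num laurent_num_residue. Qed.

Lemma exp_form_regular_zero c Q Qt : ((size Qt <= 1)%N -> c != 0) ->
  (laurent_num (size Qt).-1 c Q Qt).[0] != 0.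
Proof.
move=> c0; rewrite laurent_num_eq0; case: ifPn => [/eqP e0|e0].
  by apply: c0; rewrite -subn_eq0 subn1 e0.
rewrite oppr_eq0 !mulf_neq0 ?two_pi_i_neq0 ?pnatr_eq0// -lead_coefE lead_coef_eq0.
by apply: contraNneq e0 => ->; rewrite size_poly0.
Qed.

Lemma exp_form_newton (F : CC R -> CC R) c P Q Qt : entire F -> P.[0] != 0 ->
  (exists w, root P w) -> F =1 exp_form c P Q Qt ->
  ((size Q <= 1)%N -> c + two_pi_i R * (size P).-1%:R != 0) ->
  ((size Qt <= 1)%N -> c != 0) -> newton_in_Rl F 1.
Proof.
move=> F_entire P00 P_root FE cinf czero; set e := (size Qt).-1.
have P0 : P != 0 by apply: contraNneq P00 => ->; rewrite horner0.
have Qte : (size Qt <= e.+1)%N by rewrite leqSpred.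
have size_le := exp_form_regular_infty e c Q Qt P0.
rewrite (introT implyP cinf) in size_le.
have [S [q [g [PE numE adm]]]] :=
  log_num_admissible P00 P_root (exp_form_regular_zero Q czero) size_le.
exists (- ('X^e * S)), q; split=> // z; rewrite -/(wexp z) => dF0 qz.
have we : wexp z ^+ e != 0 by rewrite expf_neq0// wexp_neq0.
have ode : F z * q.[wexp z] = cderiv F z * (wexp z ^+ e * S.[wexp z]).
  have := is_derive_exp_form c P Q z Qte; rewrite -(funext FE : F = _).
  move=> /(is_derive_unique (is_derive_entire F_entire z)) ->.
  by rewrite FE /exp_form numE {1}PE !hornerM; field.
rewrite /newton mul1r hornerN hornerM hornerXn mulNr; congr (_ - _).
by apply/eqP; rewrite eqr_div// ode mulrC.
Qed.

End ExponentialForm.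

Section NewtonLinearPartOne.
Variables (R : realType) (F : CC R -> CC R) (p q : {poly CC R}).
Hypothesis F_entire : entire F.
Hypothesis F_root : exists z, F z = 0.
Hypothesis F_neq0 : exists z, F z != 0.
Hypothesis pq_coprime : coprimep p q.
Hypothesis q00 : q.[0] != 0.
Hypothesis p_neq0 : p != 0.
Hypothesis size_pq : (size p <= size q)%N.
Hypothesis newtonE : forall z, cderiv F z != 0 -> q.[wexp z] != 0 ->
  newton F z = 1%:~R * z + p.[wexp z] / q.[wexp z].

Let q_neq0 : q != 0.
Proof. by apply: contraNneq q00 => ->; rewrite horner0. Qed.

Lemma newton_root_residue x : x != 0 -> root p x ->
  exists n : nat, - q.[x] = n%:R * (two_pi_i R * x * p^`().[x]).
Proof.
move=> x0 px; have [z zE] := wexp_surj x0.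
have den0 : newton_den (1 - 1%:~R) p q z = 0.
  by rewrite /newton_den subrr !mul0r sub0r zE (rootP px) oppr0.
have [n nE] := newton_den_root_residue F_entire F_root F_neq0 p_neq0 q_neq0 pq_coprime newtonE den0.
exists n.+1; move: nE; rewrite subrr !mul0r addr0 sub0r zE horner_wderiv => ->; ring.
Qed.

Lemma newton_partial_fractions : exists e P T,
  [/\ P.[0] != 0, forall x, root P x -> root p x, T.[0] != 0,
      (size ('X^e * P)%R <= size (log_num e P T))%N &
      - q * ('X^e * P) = p * log_num e P T].
Proof.
have [e [p1 p10 pE]] := multiplicity_XsubC p 0; rewrite p_neq0 subr0 /= in p10 pE.
have p1_neq0 : p1 != 0 by apply: contraNneq p10 => ->; rewrite root0.
have p1_root x : root p1 x -> [/\ x != 0, root p x & p^`().[x] = p1^`().[x] * x ^+ e].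
  move=> p1x; split; [by apply: contraNneq p10 => <-|by rewrite pE rootM p1x|].
  by rewrite pE derivM hornerD !hornerM (rootP p1x) mul0r addr0 hornerXn.
have q_neq0_at x : root p x -> q.[x] != 0 by move=> px; exact: coprimep_root pq_coprime px.
have [x|x|P [T [P0 P_root PE]]] :=
    @log_partial_fractions _ p1 (- q) (two_pi_i R *: 'X^(e.+1)) p1_neq0.
- move=> /p1_root[x0 px p'x]; apply: contraNneq (q_neq0_at x px) => p1'x.
  have [n /eqP] := newton_root_residue x0 px.
  by rewrite p'x p1'x mul0r !mulr0 oppr_eq0.
- move=> /p1_root[x0 px p'x]; have [n nE] := newton_root_residue x0 px; exists n.
  by rewrite hornerN nE p'x hornerZ hornerXn exprS; ring.
have numE : - q * P = p1 * log_num e P T.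
  by rewrite PE /log_num /wderiv exprSr -scalerAr -scalerAl !mulrA.
have P00 : P.[0] != 0 by apply: contra p10 => /P_root.
have crossE : - q * ('X^e * P) = p * log_num e P T by rewrite mulrCA numE pE; ring.
exists e, P, T; split=> //.
- by move=> x /P_root /p1_root[].
- have := congr1 (horner^~ 0) numE; rewrite /= hornerM hornerN hornerM hornerD !hornerM.
  rewrite horner_wderiv !(mulr0, mul0r) add0r => num0.
  have : - q.[0] * P.[0] != 0 by rewrite mulf_neq0// oppr_eq0.
  by rewrite num0 !mulf_eq0 !negb_or => /and3P[].
- apply: leq_size_cross p_neq0 _ (esym crossE) _; last by rewrite size_polyN.
  apply: contraTneq (mulf_neq0 q_neq0 P0) => num0; rewrite -oppr_eq0 -mulNr numE num0 mulr0.
  by rewrite eqxx.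
Qed.

Lemma newton_exp_form : exists c P Q Qt,
  [/\ P.[0] != 0, F =1 exp_form c P Q Qt,
      (size Q <= 1)%N -> c + two_pi_i R * (size P).-1%:R != 0 &
      (size Qt <= 1)%N -> c != 0].
Proof.
have [e [P [T [P00 P_root T00 size_le numE]]]] := newton_partial_fractions.
have P0 : P != 0 by apply: contraNneq P00 => ->; rewrite horner0.
have [Q [Qt [Qte TE]]] := laurent_num_surj e T; set c := T`_e in TE.
have [k kE] : exists k, F =1 fun z => k * exp_form c P Q Qt z.
  apply: (linear_ode_proportional (newton_domain_codiscrete 1 p_neq0 q_neq0)
    (is_derive_entire F_entire) (fun z => is_derive_exp_form c P Q z Qte)
    (k := fun z => q.[wexp z] / newton_den (1 - 1%:~R) p q z)).
  - move=> z [_ pz]; rewrite mulf_neq0 ?cexp_neq0//; apply: contra pz => /P_root/rootP pz.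
    by rewrite /newton_den subrr !mul0r pz subrr.
  - exact: (newton_log_derivative F_entire F_root p_neq0 q_neq0 newtonE).
  - move=> z [_]; rewrite /newton_den subrr !mul0r sub0r oppr_eq0 -TE => pz.
    have we : wexp z ^+ e != 0 by rewrite expf_neq0// wexp_neq0.
    have := congr1 (horner^~ (wexp z)) numE; rewrite /= !hornerM hornerN hornerXn => num_z.
    have -> : (log_num e P T).[wexp z] = - q.[wexp z] * (wexp z ^+ e * P.[wexp z]) / p.[wexp z].
      by rewrite num_z mulrC mulKf.
    by rewrite /exp_form; field; rewrite ?we ?pz.
have k0 : k != 0 by case: F_neq0 => z; apply: contraNneq => k0; rewrite kE k0 mul0r.
exists c, (k *: P), Q, Qt; split.
- by rewrite hornerZ mulf_neq0.
- by move=> z; rewrite kE /exp_form hornerZ mulrA.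
- rewrite size_scale// => Q1; move: size_le; rewrite TE exp_form_regular_infty//.
  by move/implyP; apply.
- move=> Qt1; move: T00; rewrite TE laurent_num_eq0; case: ifPn => // e0.
  by rewrite nth_default ?mulr0 ?oppr0 ?eqxx// (leq_trans Qt1)// lt0n.
Qed.

End NewtonLinearPartOne.

Theorem theoremC (R : realType) (F : CC R -> CC R) (l : int) :
  entire F ->
  (exists z0 : CC R, F z0 = 0) ->
  (exists z1 : CC R, F z1 != 0) ->
  newton_in_Rl F l <->
  (l = 1 /\
   exists (Lam : CC R) (m0 : int) (P Q Qt : {poly CC R}),
     [/\ P.[0] != 0,
         (exists w : CC R, w != 0 /\ root P w),
         (forall z : CC R,
            let w := cexp (two_pi_i R * z) in
            F z = cexp (Lam * z) * (w ^ m0 * P.[w] * cexp (Q.[w] + Qt.[w^-1]))),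
         ((size Q <= 1)%N -> Lam != - two_pi_i R * (m0 + ((size P).-1)%:Z)%:~R) &
         ((size Qt <= 1)%N -> Lam != - two_pi_i R * m0%:~R)]).
Proof.
move=> F_entire F_root F_neq0; split=> [[p [q [[cop _ q00 size_pq q_root] newtonE]]]|].
  have p0 : p != 0.
    apply: contraTneq cop => ->; rewrite coprime0p; case: q_root => w qw.
    by apply: contraTN qw => /eqp_root ->; rewrite root1.
  have l1 := newton_map_linear_coef F_entire F_root F_neq0 p0 q00 cop q_root newtonE.
  split=> //; rewrite l1 in newtonE.
  have [c [P [Q [Qt [P00 FE cinf czero]]]]] :=
    newton_exp_form F_entire F_root F_neq0 cop q00 p0 size_pq newtonE.
  exists c, 0, P, Q, Qt; split=> //.
  - have [z Fz] := F_root; exists (wexp z); split; first exact: wexp_neq0.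
    apply/rootP/eqP; move/eqP: Fz; rewrite FE mulf_eq0 => /orP[//|].
    by rewrite (negbTE (cexp_neq0 _)).
  - by move=> z /=; rewrite FE exp_formE mulr0 addr0.
  - by move=> /cinf; rewrite add0r mulNr addr_eq0 pmulrn.
  - by move=> /czero; rewrite mulr0.
move=> [-> [Lam [m0 [P [Q [Qt [P00 [w [_ Pw]] FE cinf czero]]]]]]].
apply: (@exp_form_newton _ _ (Lam + two_pi_i R * m0%:~R) P Q Qt) => //.
- by exists w.
- by move=> z; rewrite FE exp_formE.
- by move/cinf; apply: contra; rewrite -addrA -mulrDr addr_eq0 mulNr intrD -pmulrn.
- by move/czero; apply: contra; rewrite addr_eq0 mulNr.
Qed.
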